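(* Let $\overline{\mathfrak{s}}$ be a primitive binary necklace of length $l$. If $\overline{\mathfrak{s}}$ has odd weight, then $l=k_Z(\mathfrak{c})$, where $\mathfrak{c}$ is the unique primitive class such that $\overline{\sigma}(\mathfrak{c})=\overline{\mathfrak{s}}$. If $\overline{\mathfrak{s}}$ has even nonzero weight and $\mathfrak{c}_1,\mathfrak{c}_2$ are the two primitive classes whose images under $\overline{\sigma}$ have underlying necklace $\overline{\mathfrak{s}}$, then $l=k_Z(\mathfrak{c}_1)+k_Z(\mathfrak{c}_2)$.
   Context: A form $(A,B,C)$ means $Ax^2+Bxy+Cy^2$ with $A,B,C\in\mathbb{Z}$; its discriminant is $\Delta=B^2-4AC$. All forms are indefinite: $\Delta$ is positive and not a square. A form is primitive if $\gcd(A,B,C)=1$. It is Z-reduced if $A,B,C>0$ and $B>A+C$; $Z$ is the set of Z-reduced forms. Two forms are equivalent if related by a substitution $f(x,y)\mapsto f(\alpha x+\beta y,\gamma x+\delta y)$ with $\left[\begin{smallmatrix}\alpha&\beta\\ \gamma&\delta\end{smallmatrix}\right]\in \mathrm{SL}_2(\mathbb{Z})$; a class is an equivalence class, primitive if its forms are primitive. The Z-caliber of a class $\mathfrak{c}$ is $k_Z(\mathfrak{c})=|\mathfrak{c}\cap Z|$. Fundamental solution: for a positive nonsquare discriminant $\Delta$, the fundamental solution of $|t^2-\Delta u^2|=4$ is the solution $(t,u)$ in positive integers with $u$ minimal (for $\Delta=5$, where $(1,1)$ and $(3,1)$ both have $u=1$, it is $(1,1)$). Map $\beta$: for $f=(A,B,C)\in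 Z$ with fundamental solution $(t,u)$, set $z=\frac{t+Bu}{2}$ (an integer) and let $\beta(f)=(q_1,\dots,q_l)$ be the partial quotients of the finite regular continued fraction expansion (positive integer partial quotients) of $\frac{z}{z-Au}$ whose length $l$ is even if $t^2-\Delta u^2=-4$ and odd otherwise; always $l\ge2$. Map $\sigma$: $\sigma(f)=\mathrm{sb}(\beta(f))$, where $\mathrm{sb}((q_1,\dots,q_l))=0^{q_1-1}1\,0^{q_2-1}1\cdots1\,0^{q_l-1}$. A binary necklace is an equivalence class of finite binary strings under cyclic rotation; its length is its number of beads (characters) and its weight is its number of $1$s; it is primitive if no nontrivial rotation fixes its strings. The weight of a class $\mathfrak{c}$ is the weight of $\sigma(f)$ for any Z-reduced $f\in\mathfrak{c}$ (all Z-reduced forms in a class give strings that are cyclic rotations of one another). An alternating string is a binary string of even weight whose $1$s are colored with two colors (green and blue) alternating along the string; an alternating necklace is an equivalence class of alternating strings under cyclic rotation (colors must match), and its underlying necklace is the binary necklace obtained by ignoring colors. The map $\overline{\sigma}$: if $\mathfrak{c}$ has odd weight, $\overline{\sigma}(\mathfrak{c})$ is the binary necklace of $\sigma(f)$ for any Z-reduced $f\in\mathfrak{c}$; if $\mathfrak{c}$ has even weight, it is the alternating necklace of $\sigma(f)$ with the $1$s alternately colored so that the first $1$ of $\sigma(f)$ from the left is green. These are well defined. $\overline{\sigma}$ restricts to a bijection from primitive classes of odd weight to primitive binary necklaces of odd weight, and to a bijection from primitive classes of even weight to alternating necklaces of nonzero weight whose underlying necklace is primitive. *)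

(* Defs.v *)
From HB Require Import structures.
From mathcomp Require Import all_boot all_order all_algebra.
From mathcomp Require Import finmap.
From mathcomp Require Import boolp classical_sets cardinality.

Set Implicit Arguments.
Unset Strict Implicit.
Unset Printing Implicit Defensive.

Import Order.TTheory GRing.Theory Num.Theory.

Local Open Scope ring_scope.
Local Open Scope classical_set_scope.
Local Open Scope quotient_scope.

Definition bqf : Type := (int * int * int)%type.

Definition bqf_eval (f : bqf) (x y : int) : int :=
  let: (A, B, C) := f in A * x ^+ 2 + B * x * y + C * y ^+ 2.

Definition disc (f : bqf) : int := let: (A, B, C) := f in B ^+ 2 - 4 * A * C.

Definition indefinite (f : bqf) : Prop :=
  0 < disc f /\ ~ exists n : int, disc f = n ^+ 2.

Definition bqf_primitive (f : bqf) : Prop :=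
  let: (A, B, C) := f in gcdz (gcdz A B) C = 1.

Definition Zreduced : set bqf :=
  [set f | indefinite f /\
    let: (A, B, C) := f in [/\ 0 < A, 0 < B, 0 < C & A + C < B]].

(* Two integral binary quadratic forms are equal iff they are equal as
   functions on Z^2, so the substitution is expressed through values. *)
Definition bqf_equiv (f g : bqf) : Prop :=
  exists a b c d : int, a * d - b * c = 1 /\
    forall x y, bqf_eval g x y = bqf_eval f (a * x + b * y) (c * x + d * y).

Definition is_class (K : set bqf) : Prop :=
  exists2 f, indefinite f & K = [set g | bqf_equiv f g].

Definition primitive_class (K : set bqf) : Prop :=
  is_class K /\ forall f, K f -> bqf_primitive f.

(* [fset_set] is the underlying finite set of a finite set, and is empty on
   infinite ones; the set below is finite, as 0 < A, C and B > A + C give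
   D = (A - C)^2 + (B - A - C) * (B + A + C) > B. *)
Definition Zcaliber (K : set bqf) : nat := #|` fset_set (K `&` Zreduced)|.

Definition pell4 (D t u : int) : Prop :=
  [/\ 0 < t, 0 < u & `|t ^+ 2 - D * u ^+ 2| = 4].

(* For D = 5 both (1, 1) and (3, 1) have u = 1; (1, 1) is selected. *)
Definition is_fundamental (D t u : int) : Prop :=
  [/\ pell4 D t u, (forall t' u', pell4 D t' u' -> u <= u')
    & (D = 5 -> (t, u) = (1, 1))].

Definition fundamental (D : int) : int * int :=
  xget (0, 0) [set tu | is_fundamental D tu.1 tu.2].

(* As 0^-1 = 0, the last partial quotient contributes itself. *)
Definition cf_value (q : seq nat) : rat :=
  foldr (fun a x => a%:R + x^-1) 0 q.

Definition is_beta (f : bqf) (q : seq nat) : Prop :=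
  let: (A, B, C) := f in
  let: (t, u) := fundamental (disc f) in
  let z : rat := (t + B * u)%:~R / 2 in
  [/\ (0 < size q)%N, all (leq 1) q, cf_value q = z / (z - (A * u)%:~R)
    & if t ^+ 2 - disc f * u ^+ 2 == - 4 then ~~ odd (size q)
      else odd (size q)].

Definition beta (f : bqf) : seq nat := xget [::] [set q | is_beta f q].

Fixpoint sb (q : seq nat) : seq bool :=
  match q with
  | [::] => [::]
  | [:: a] => nseq a.-1 false
  | a :: q' => nseq a.-1 false ++ true :: sb q'
  end.

Definition sigma (f : bqf) : seq bool := sb (beta f).

Definition rot_equiv (T : eqType) (s1 s2 : seq T) : bool :=
  [exists n : 'I_(size s1).+1, s2 == rot n s1].

Lemma rot_equivP (T : eqType) (s1 s2 : seq T) :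
  reflect (exists n, s2 = rot n s1) (rot_equiv s1 s2).
Proof.
apply: (iffP existsP) => [[n /eqP ->]|[n ->]]; first by exists n.
have [n_le|n_gt] := leqP n (size s1).
  by exists (Ordinal (n_le : (n < (size s1).+1)%N)).
by exists ord0; rewrite rot0 rot_oversize // ltnW.
Qed.

Lemma rot_equiv_refl (T : eqType) : reflexive (@rot_equiv T).
Proof. by move=> s; apply/rot_equivP; exists 0%N; rewrite rot0. Qed.

Lemma rot_equiv_sym (T : eqType) : symmetric (@rot_equiv T).
Proof.
have sub s1 s2 : @rot_equiv T s1 s2 -> rot_equiv s2 s1.
  move=> /rot_equivP[n ->]; apply/rot_equivP.
  by exists (size (rot n s1) - n)%N; exact/esym/rotK.
by move=> s1 s2; apply/idP/idP; exact: sub.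
Qed.

Lemma rot_equiv_trans (T : eqType) : transitive (@rot_equiv T).
Proof.
move=> s2 s1 s3 /rot_equivP[m ->] /rot_equivP[n ->]; apply/rot_equivP.
have [mle|/ltnW mgt] := leqP m (size s1); last first.
  by exists n; rewrite (rot_oversize mgt).
have [nle|/ltnW ngt] := leqP n (size s1); last first.
  by exists m; rewrite [LHS]rot_oversize // size_rot.
rewrite rot_add_mod //; by eexists.
Qed.

Canonical rot_equivR (T : eqType) :=
  EquivRel (@rot_equiv T) (@rot_equiv_refl T) (@rot_equiv_sym T)
    (@rot_equiv_trans T).

Definition necklace (T : choiceType) : Type := {eq_quot (@rot_equiv T)}.

HB.instance Definition _ (T : choiceType) :=
  EqQuotient.on (necklace T).
HB.instance Definition _ (T : choiceType) := Choice.on (necklace T).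

Definition to_necklace (T : choiceType) (s : seq T) : necklace T :=
  \pi_(necklace T) s.

Lemma to_necklaceP (T : choiceType) (s1 s2 : seq T) :
  to_necklace s1 = to_necklace s2 <-> exists n, s2 = rot n s1.
Proof.
rewrite /to_necklace; split=> [/eqmodP/rot_equivP //|h].
by apply/eqmodP/rot_equivP.
Qed.

Lemma repr_rot (T : choiceType) (s : seq T) :
  exists n, repr (to_necklace s) = rot n s.
Proof. by apply/to_necklaceP; rewrite /to_necklace reprK. Qed.

Definition string_weight (s : seq bool) : nat := count id s.

Definition string_primitive (s : seq bool) : Prop :=
  forall n, (0 < n < size s)%N -> rot n s <> s.

Definition necklace_length (N : necklace bool) : nat := size (repr N).

Definition necklace_weight (N : necklace bool) : nat := string_weight (repr N).

Definition necklace_primitive (N : necklace bool) : Prop :=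
  forall s, to_necklace s = N -> string_primitive s.

Lemma necklace_lengthE (s : seq bool) :
  necklace_length (to_necklace s) = size s.
Proof.
by rewrite /necklace_length; have [n ->] := repr_rot s; rewrite size_rot.
Qed.

Lemma necklace_weightE (s : seq bool) :
  necklace_weight (to_necklace s) = string_weight s.
Proof.
rewrite /necklace_weight /string_weight; have [n ->] := repr_rot s.
by apply/permP; rewrite perm_rot.
Qed.

(* [None] is the character 0, [Some true] a green 1, [Some false] a blue 1. *)
Definition bead : Type := option bool.

Definition is_one (b : bead) : bool := if b is Some _ then true else false.

Definition alternating_string (w : seq bead) : bool :=
  ~~ odd (count is_one w) && sorted (fun x y => x != y) (pmap id w).

Fixpoint color_from (c : bool) (s : seq bool) : seq bead :=
  match s with
  | [::] => [::]
  | true :: s' => Some c :: color_from (~~ c) s'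
  | false :: s' => None :: color_from c s'
  end.

Definition color (s : seq bool) : seq bead := color_from true s.

Lemma color_fromK c s : map is_one (color_from c s) = s.
Proof. by elim: s c => [|[] s IH] c //=; rewrite IH. Qed.

Lemma color_alternating (s : seq bool) :
  ~~ odd (string_weight s) -> alternating_string (color s).
Proof.
move=> s_even; apply/andP; split.
  by rewrite -(count_map is_one id) /color color_fromK.
have path_color (t : seq bool) (c : bool) :
    path (fun x y : bool => x != y) c (pmap id (color_from (~~ c) t)).
  elim: t c => [|[] t IH] c //=.
  by rewrite IH andbT; case: c.
exact: path_sorted (path_color s false).
Qed.

Definition underlying (a : necklace bead) : necklace bool :=
  to_necklace (map is_one (repr a)).

Lemma underlyingE (w : seq bead) :
  underlying (to_necklace w) = to_necklace (map is_one w).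
Proof.
apply/esym/to_necklaceP; have [n ->] := repr_rot w.
by exists n; rewrite map_rot.
Qed.

Definition Zrepresentative (K : set bqf) : bqf :=
  xget (0, 0, 0) (K `&` Zreduced).

Definition class_weight (K : set bqf) : nat :=
  string_weight (sigma (Zrepresentative K)).

Definition sigma_bar (K : set bqf) : necklace bool + necklace bead :=
  let s := sigma (Zrepresentative K) in
  if odd (class_weight K) then inl (to_necklace s)
  else inr (to_necklace (color s)).

(* The image of K under [sigma_bar] is an alternating necklace over N. *)
Definition image_over (K : set bqf) (N : necklace bool) : Prop :=
  exists2 a, sigma_bar K = inr a & underlying a = N.

(* Main.v *)
Require Import Defs.
From mathcomp Require Import all_boot all_order all_algebra.
From mathcomp Require Import finmap zify ring.
From mathcomp Require Import boolp classical_sets cardinality.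

(** Send the letter 0 to [1 1; 0 1], the letter 1 to [0 1; 1 1], and a binary
    word to the product of its letters ([word_mx]). The nonempty words are in
    bijection with the matrices of determinant 1 or -1 whose columns satisfy
    0 <= first column <= second column ([ordered_wordP], [word_mx_inj]), and
    the determinant is -1 to the power of the weight of the word.

    On the other side, attach to f = (A, B, C) a traceless matrix [form_mx f],
    so that proper equivalence of forms becomes conjugation by SL_2(Z)
    ([bqf_equivP]). If f is Z-reduced and (t, u) is a positive solution of
    |t^2 - D u^2| = 4, the matrix (t + u form_mx f) / 2 is integral, has
    determinant 1 or -1, and its columns are ordered as above ([pell_word]);
    for the fundamental solution it is exactly the matrix of the word sigma(f)
    ([sigma_word]), because the partial quotients of z / (z - A u) factor that
    matrix. Conversely, a word of nonzero weight determines a primitive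
    Z-reduced form, by dividing the traceless part of its matrix by its
    content ([mx_form]). On primitive words of nonzero weight and primitive
    Z-reduced forms these two maps are inverse to each other
    ([sigma_mx_form], [form_of_sigma]).

    Rotating a word conjugates its matrix by the matrix of the prefix that is
    moved. Conversely, words whose matrices are conjugate in GL_2(Z) are
    rotations of each other ([conjugate_word_mx]), so that all the Z-reduced
    forms of a primitive class are obtained from the rotations of one word.
    Hence the l distinct rotations of a primitive word of length l and nonzero
    weight produce l distinct Z-reduced forms, and these fill up the traces on
    Z of the classes lying over the necklace of that word. There remains to
    see how many classes there are.

    If the weight is odd, the matrix of the word has determinant -1 and
    commutes with the matrix of the form; it corrects the sign of the
    conjugating matrix, so that all l forms are properly equivalent. If the
    weight is even, moving a prefix of odd weight leaves the proper class:
    otherwise some matrix of determinant -1 would commute with the matrix of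
    the word, which would produce a word commuting with the given one and of
    odd weight, whereas such a word is a power of the given one
    ([commute_power]). So the rotations split, according to the parity of the
    weight of the prefix, into exactly two classes, and l is the sum of the
    two calibers. *)

Set Implicit Arguments.
Unset Strict Implicit.
Unset Printing Implicit Defensive.
Import Order.TTheory GRing.Theory Num.Theory.
Local Open Scope ring_scope.
Local Open Scope classical_set_scope.
Local Notation mat2 := 'M[int]_2.

(** * Integer matrices of size two *)

Definition mx2 (a b c d : int) : mat2 :=
  \matrix_(i, j) (if i == 0 then if j == 0 then a else b
                  else if j == 0 then c else d).

Lemma ord2_ind (P : 'I_2 -> Prop) : P 0 -> P 1 -> forall i, P i.
Proof.
move=> P0 P1 [[|[|//]] lti].
  by rewrite (_ : Ordinal _ = 0) //; apply: val_inj.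
by rewrite (_ : Ordinal _ = 1) //; apply: val_inj.
Qed.

Lemma mx2E a b c d :
  (mx2 a b c d 0 0 = a) * (mx2 a b c d 0 1 = b) *
  (mx2 a b c d 1 0 = c) * (mx2 a b c d 1 1 = d).
Proof. by rewrite !mxE. Qed.

Lemma mx2P (M : mat2) : exists a b c d, M = mx2 a b c d.
Proof.
exists (M 0 0), (M 0 1), (M 1 0), (M 1 1); apply/matrixP.
by apply: ord2_ind; apply: ord2_ind; rewrite mx2E.
Qed.

Lemma mx2_inj a b c d a' b' c' d' :
  mx2 a b c d = mx2 a' b' c' d' -> [/\ a = a', b = b', c = c' & d = d'].
Proof.
move=> /matrixP eqM.
by have := (eqM 0 0, eqM 0 1, eqM 1 0, eqM 1 1); rewrite !mx2E => -[[[]]].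
Qed.

Lemma mx2M a b c d a' b' c' d' :
  mx2 a b c d * mx2 a' b' c' d' =
  mx2 (a * a' + b * c') (a * b' + b * d') (c * a' + d * c') (c * b' + d * d').
Proof.
have lift1 : lift ord0 ord0 = 1 :> 'I_2 by apply: val_inj.
by apply/matrixP; apply: ord2_ind; apply: ord2_ind;
  rewrite -mulmxE !mxE !big_ord_recl big_ord0 addr0 lift1 !mx2E.
Qed.

Lemma mx2_1 : 1 = mx2 1 0 0 1.
Proof. by apply/matrixP; apply: ord2_ind; apply: ord2_ind; rewrite !mxE. Qed.

Lemma mx2D a b c d a' b' c' d' :
  mx2 a b c d + mx2 a' b' c' d' = mx2 (a + a') (b + b') (c + c') (d + d').
Proof. by apply/matrixP; apply: ord2_ind; apply: ord2_ind; rewrite !mxE. Qed.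

Lemma mx2Z k a b c d : k *: mx2 a b c d = mx2 (k * a) (k * b) (k * c) (k * d).
Proof. by apply/matrixP; apply: ord2_ind; apply: ord2_ind; rewrite !mxE. Qed.

Lemma mx2N a b c d : - mx2 a b c d = mx2 (- a) (- b) (- c) (- d).
Proof. by apply/matrixP; apply: ord2_ind; apply: ord2_ind; rewrite !mxE. Qed.

Lemma det_mx2 a b c d : \det (mx2 a b c d) = a * d - b * c.
Proof.
rewrite (expand_det_row _ 0) !big_ord_recl big_ord0 addr0 /cofactor !det_mx11.
by rewrite !mxE /= expr0 expr1 mul1r mulN1r mulrN.
Qed.

Lemma detMr (M N : mat2) : \det (M * N) = \det M * \det N.
Proof. by rewrite -mulmxE det_mulmx. Qed.

Definition unimodular (M : mat2) : bool := (\det M == 1) || (\det M == -1).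

Lemma unimodularM M N : unimodular (M * N) = unimodular M && unimodular N.
Proof.
rewrite /unimodular detMr; move: (\det M) (\det N) => x y.
apply/idP/idP; last by case/andP=> /orP[]/eqP-> /orP[]/eqP->.
move=> xy1; have : (`|x| * `|y| = 1)%N.
  by rewrite -abszM; case/orP: xy1 => /eqP->.
by move/eqP; rewrite muln_eq1; lia.
Qed.

Lemma unimodular_lreg M X Y : unimodular M -> M * X = M * Y -> X = Y.
Proof.
move=> uM /(congr1 (fun Z => \adj M * Z)); rewrite !mulrA -!mulmxE mul_adj_mx.
rewrite !mul_scalar_mx; case/orP: uM => /eqP->; first by rewrite !scale1r.
by rewrite !scaleN1r => /oppr_inj.
Qed.

Lemma unimodular_inv (G : mat2) : unimodular G ->
  exists2 H : mat2, \det H = \det G & G * H = 1 /\ H * G = 1.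
Proof.
have [p [q [r [v ->]]]] := mx2P G; rewrite /unimodular det_mx2.
set d := p * v - q * r => /pred2P d1; have dd : d * d = 1 by case: d1 => ->.
exists (d *: mx2 v (- q) (- r) p).
  by rewrite mx2Z det_mx2 -[RHS]mulr1 -dd /d; ring.
by rewrite mx2Z !mx2M mx2_1 -dd /d; split; congr mx2; ring.
Qed.

Lemma intertwine_inv (G H P Q : mat2) :
  G * H = 1 -> H * G = 1 -> P * G = G * Q -> Q * H = H * P.
Proof.
move=> GH HG PG.
by rewrite -[Q * H]mul1r -HG -mulrA (mulrA G) -PG -!mulrA GH mulr1.
Qed.

Lemma intertwine_exp (P Q G : mat2) n :
  P * G = G * Q -> P ^+ n * G = G * Q ^+ n.
Proof.
move=> PG; elim: n => [|n IH]; first by rewrite !expr0 mul1r mulr1.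
by rewrite exprS -mulrA IH mulrA PG -mulrA -exprS.
Qed.

Lemma unimodular_det (M : mat2) : unimodular M -> \det M = 1 \/ \det M = -1.
Proof. by case/orP=> /eqP; [left|right]. Qed.

Lemma scalemx_inj (k : int) (M N : mat2) : k != 0 -> k *: M = k *: N -> M = N.
Proof.
move=> k0 eqMN; apply/matrixP=> i j; move/matrixP/(_ i j): eqMN; rewrite !mxE.
exact: mulfI.
Qed.

Lemma tr_conj (M N G : mat2) : unimodular G -> M * G = G * N ->
  M 0 0 + M 1 1 = N 0 0 + N 1 1.
Proof.
move=> /unimodular_inv[H _ [GH HG]] MG.
have tr2 (P : mat2) : P 0 0 + P 1 1 = \tr P.
  rewrite /mxtrace !big_ord_recl big_ord0 addr0; congr (_ + P _ _);
  exact: val_inj.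
have -> : N = H * (M * G) by rewrite MG mulrA HG mul1r.
by rewrite !tr2 mulrA -!mulmxE mxtrace_mulC mulmxE mulrA GH mul1r.
Qed.

(** * Combinatorics of binary words *)

Lemma catsI (T : Type) (m : seq T) : injective (cat m).
Proof. by elim: m => //= x m IH a b [/IH]. Qed.

(** If [m] is longer than [s1], it begins with [s1], which can be cancelled;
    when it is shorter, [s1] is [m] followed by the word [r], and [s2] is [r]
    followed by [m]. *)
Lemma conjugate_rot (T : eqType) (s1 s2 m : seq T) :
  s1 != [::] -> s1 ++ m = m ++ s2 -> exists n, s2 = rot n s1.
Proof.
move=> s1_n0; have [n] := ubnP (size m); elim: n m => // n IH m lt_m eq_m.
have [le_m|lt_s1] := leqP (size m) (size s1).
  have take_s1 : take (size m) s1 = m.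
    by rewrite -(takel_cat m le_m) eq_m take_size_cat.
  exists (size m); rewrite /rot take_s1.
  apply: (@catsI _ m).
  by rewrite -eq_m -{1}(cat_take_drop (size m) s1) take_s1 catA.
have take_m : take (size s1) m = s1.
  by rewrite -(takel_cat s2 (ltnW lt_s1)) -eq_m take_size_cat.
apply: (IH (drop (size s1) m)).
  rewrite size_drop; have : (0 < size s1)%N by rewrite lt0n size_eq0.
  lia.
have def_m : s1 ++ drop (size s1) m = m by rewrite -{1}take_m cat_take_drop.
by apply: (@catsI _ s1); rewrite [RHS]catA def_m.
Qed.

(** The same descent as for conjugate words: a nonempty [m] shorter than [s]
    would rotate [s] onto itself, which primitivity forbids. *)
Lemma commute_power (s m : seq bool) : string_primitive s -> s != [::] ->
  s ++ m = m ++ s -> exists k, m = flatten (nseq k s).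
Proof.
move=> s_prim s_n0; have [n] := ubnP (size m); elim: n m => // n IH m lt_m eq_m.
have [->|m_n0] := eqVneq m [::]; first by exists 0%N.
have [lt_ms|le_s] := ltnP (size m) (size s).
  have take_s : take (size m) s = m.
    by rewrite -(takel_cat m (ltnW lt_ms)) eq_m take_size_cat.
  case: (s_prim (size m)); first by rewrite lt0n size_eq0 m_n0.
  rewrite /rot take_s; apply: (@catsI _ m).
  by rewrite -eq_m catA -{1}take_s cat_take_drop.
have take_m : take (size s) m = s.
  by rewrite -(takel_cat s le_s) -eq_m take_size_cat.
have def_m : s ++ drop (size s) m = m by rewrite -{1}take_m cat_take_drop.
have [||k eq_k] := IH (drop (size s) m).
- rewrite size_drop; have : (0 < size s)%N by rewrite lt0n size_eq0.
  lia.
- by apply: (@catsI _ s); rewrite [RHS]catA def_m.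
- by exists k.+1; rewrite /= -eq_k def_m.
Qed.

Lemma string_weight_rot n s : string_weight (rot n s) = string_weight s.
Proof. by apply/permP; rewrite perm_rot. Qed.

Lemma rot_lt_size (s : seq bool) n : s != [::] ->
  exists2 i, (i < size s)%N & rot n s = rot i s.
Proof.
move=> s_n0; have [lt_n|le_n] := ltnP n (size s); first by exists n.
by exists 0%N; rewrite ?lt0n ?size_eq0 // rot0 rot_oversize.
Qed.

Lemma primitive_rot_inj s : string_primitive s ->
  {in gtn (size s) &, injective (fun n => rot n s)}.
Proof.
move=> s_prim i j; wlog le_ij : i j / (i <= j)%N => [IH lt_i lt_j eq_ij|].
  case/orP: (leq_total i j) => le; first exact: IH.
  by apply/esym/IH.
rewrite !inE => lt_i lt_j eq_ij; have [//|ne_ij] := eqVneq i j.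
case: (s_prim (j - i)%N); first by lia.
by apply: (@rot_inj i _); rewrite eq_ij rot_rot -rotD subnK // ltnW.
Qed.

Lemma string_primitive_rot n s :
  string_primitive s -> string_primitive (rot n s).
Proof.
move=> s_prim i; rewrite size_rot => lt_i eq_i; apply: (s_prim i lt_i).
by apply: (@rot_inj n _); rewrite rot_rot.
Qed.

(** * The free monoid of word matrices *)

(** With S the exchange of coordinates and T the shear [1 1; 0 1], the letters
    0 and 1 are T and S T. A factor [a 1; 1 0] of a continued fraction is
    T^a S, which explains why a partial quotient a becomes a - 1 letters 0,
    separated by letters 1. *)
Definition letter_mx (b : bool) : mat2 :=
  if b then mx2 0 1 1 1 else mx2 1 1 0 1.

Definition word_mx (s : seq bool) : mat2 := \prod_(b <- s) letter_mx b.

Lemma word_mx_cons b s : word_mx (b :: s) = letter_mx b * word_mx s.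
Proof. by rewrite /word_mx big_cons. Qed.

Lemma word_mx_cat s1 s2 : word_mx (s1 ++ s2) = word_mx s1 * word_mx s2.
Proof. by rewrite /word_mx big_cat. Qed.

Lemma word_mx1 b : word_mx [:: b] = letter_mx b.
Proof. by rewrite /word_mx big_seq1. Qed.

Lemma word_mx0 : word_mx [::] = 1.
Proof. by rewrite /word_mx big_nil. Qed.

Lemma det_word s : \det (word_mx s) = (-1) ^+ string_weight s.
Proof.
elim: s => [|b s IH]; first by rewrite word_mx0 det1.
rewrite word_mx_cons detMr IH /string_weight /= exprD.
by case: b; rewrite /letter_mx det_mx2.
Qed.

(** The conditions 0 <= first column <= second column, entry by entry, cut out
    the image of the nonempty words among the unimodular matrices. *)
Definition ordered (M : mat2) : bool :=
  [&& 0 <= M 0 0, M 0 0 <= M 0 1, 0 <= M 1 0 & M 1 0 <= M 1 1].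

Lemma ordered_mx2 a b c d :
  ordered (mx2 a b c d) = [&& 0 <= a, a <= b, 0 <= c & c <= d].
Proof. by rewrite /ordered !mx2E. Qed.

Lemma ordered_word s : s != [::] -> ordered (word_mx s).
Proof.
elim: s => [//|b [|b' s] IH] _.
  by rewrite word_mx1; case: b; rewrite ordered_mx2.
rewrite word_mx_cons; move: {IH}(IH isT).
have [p [q [r [v ->]]]] := mx2P (word_mx (b' :: s)).
by rewrite ordered_mx2 /letter_mx; case: b; rewrite mx2M ordered_mx2; lia.
Qed.

Lemma unimodular_word s : unimodular (word_mx s).
Proof. by rewrite /unimodular det_word -signr_odd; case: odd. Qed.

Lemma ordered_col1_gt0 M : ordered M -> unimodular M ->
  0 < M 0 1 /\ 0 < M 1 1.
Proof.
have [p [q [r [v ->]]]] := mx2P M.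
by rewrite ordered_mx2 !mx2E /unimodular det_mx2; split; nia.
Qed.

(** Descent on the second column. If (c1, c2) are the columns, the last letter
    is 0 when c2 - c1 >= c1 and 1 when c2 - c1 <= c1, the remaining columns
    being (c1, c2 - c1) or (c2 - c1, c1). When neither inequality holds in both
    rows, determinant 1 or -1 leaves only the two letters themselves. *)
Lemma ordered_wordP M : ordered M -> unimodular M ->
  exists2 s, s != [::] & word_mx s = M.
Proof.
have [n] := ubnP `|(M 0 1 + M 1 1)%R|%N; elim: n M => // n IH M.
have [p [q [r [v ->]]]] := mx2P M.
rewrite ordered_mx2 !mx2E /unimodular det_mx2 => lt_n ord uni.
have peel b M' : mx2 p q r v = M' * letter_mx b -> ordered M' ->
    (`|(M' 0 1 + M' 1 1)%R| < n)%N ->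
    exists2 s, s != [::] & word_mx s = mx2 p q r v.
  move=> eqM ordM' ltM'.
  have uniM' : unimodular M'.
    move: uni; rewrite -det_mx2 eqM detMr /unimodular.
    by case: (b); rewrite /letter_mx det_mx2; lia.
  have [s s0 eq_s] := IH _ ltM' ordM' uniM'.
  exists (rcons s b); first by case: (s).
  by rewrite -cats1 word_mx_cat eq_s word_mx1 -eqM.
have [/andP[le1 le2]|nT] := boolP ((2 * p <= q) && (2 * r <= v)).
  apply: (peel false (mx2 p (q - p) r (v - r))).
  - by rewrite mx2M; congr mx2; lia.
  - by rewrite ordered_mx2; lia.
  - rewrite !mx2E. have : p + r != 0 by apply/eqP => ?; nia.
    lia.
have [/andP[le1 le2]|nU] := boolP ((q <= 2 * p) && (v <= 2 * r)).
  apply: (peel true (mx2 (q - p) p (v - r) r)).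
  - by rewrite mx2M; congr mx2; lia.
  - by rewrite ordered_mx2; lia.
  - rewrite !mx2E. have : ~ (p = q /\ r = v) by move=> [? ?]; nia.
    lia.
have [le1|lt1] := leP (2 * p) q.
  have [-> -> -> ->] : [/\ p = 0, q = 1, r = 1 & v = 1] by split; nia.
  by exists [:: true] => //; rewrite word_mx1.
have [-> -> -> ->] : [/\ p = 1, q = 1, r = 0 & v = 1] by split; nia.
by exists [:: false] => //; rewrite word_mx1.
Qed.
Lemma word_mx11_gt0 s : 0 < word_mx s 1 1.
Proof.
have [->|s_n0] := eqVneq s [::]; first by rewrite word_mx0 mx2_1 mx2E.
move: (ordered_word s_n0) (unimodular_word s).
have [p [q [r [v ->]]]] := mx2P (word_mx s).
by rewrite ordered_mx2 /unimodular det_mx2 mx2E; nia.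
Qed.

(** The vector (1, 1) tells the first letter of a word: its image has a larger
    first coordinate if the letter is 0, a larger second coordinate if it is
    1, and equal coordinates for the empty word. Vectors are encoded as
    matrices with a zero second column. *)
Lemma word_mx_sums s : exists x y : int,
  [/\ word_mx s * mx2 1 0 1 0 = mx2 x 0 y 0, 0 < x & 0 < y].
Proof.
elim: s => [|b s [x [y [IH x0 y0]]]].
  by exists 1, 1; rewrite word_mx0 mul1r.
case: b.
  exists y, (x + y); rewrite word_mx_cons -mulrA IH mx2M; split; try lia.
  by congr mx2; ring.
exists (x + y), y; rewrite word_mx_cons -mulrA IH mx2M; split; try lia.
by congr mx2; ring.
Qed.

Lemma word_mx_inj : injective word_mx.
Proof.
move=> s; elim: s => [|b s IH] [|b' s'] //.
- case: (word_mx_sums s') => x [y [eq_s' x0 y0]].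
  move=> /(congr1 (fun M => M * mx2 1 0 1 0)).
  rewrite word_mx0 mul1r word_mx_cons -mulrA eq_s' /letter_mx; case: (b');
  by rewrite mx2M => /mx2_inj[]; lia.
- case: (word_mx_sums s) => x [y [eq_s x0 y0]].
  move=> /(congr1 (fun M => M * mx2 1 0 1 0)).
  rewrite word_mx0 mul1r word_mx_cons -mulrA eq_s /letter_mx; case: (b);
  by rewrite mx2M => /mx2_inj[]; lia.
rewrite !word_mx_cons => eq_bs; suff eq_b : b = b'.
  rewrite eq_b in eq_bs *; congr cons; apply: IH; apply: unimodular_lreg eq_bs.
  by rewrite -word_mx1 unimodular_word.
case: (word_mx_sums s) => x [y [eq_s x0 y0]].
case: (word_mx_sums s') => x' [y' [eq_s' x'0 y'0]].
move/(congr1 (fun M => M * mx2 1 0 1 0)): eq_bs.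
by rewrite -!mulrA eq_s eq_s' /letter_mx; case: b b' => [] [] //;
  rewrite !mx2M => /mx2_inj[]; lia.
Qed.

Lemma word_mx_power k s : word_mx (flatten (nseq k s)) = word_mx s ^+ k.
Proof.
elim: k => [|k IH] /=; first by rewrite word_mx0.
by rewrite word_mx_cat IH exprS.
Qed.

Lemma size_power (T : Type) k (s : seq T) :
  size (flatten (nseq k s)) = (k * size s)%N.
Proof. by elim: k => //= k IH; rewrite size_cat IH mulSn. Qed.

(** Right multiplication by a letter turns a row (x, y) into (x, x + y) or
    (y, x + y). A row without sign change remains so; a row with a sign change
    that persists has lost at least 1 in |x| + |y|. Hence every row loses its
    sign change after |x| + |y| letters: this replaces the convergence of the
    rows to the dominant eigendirection. *)
Lemma row_settles (G : mat2) s i :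
  0 <= G i 0 * G i 1 \/ (`|G i 0| + `|G i 1| <= (size s)%:Z)%R ->
  0 <= (G * word_mx s) i 0 * (G * word_mx s) i 1.
Proof.
elim: s G => [|b s IH] G.
  by rewrite word_mx0 mulr1; move: (G i 0) (G i 1) => x y /= [|]; nia.
move=> settled; rewrite word_mx_cons mulrA; apply: IH.
move: settled; move: i; have [p [q [r [v ->]]]] := mx2P G.
by apply: ord2_ind; case: b; rewrite mx2M !mx2E /=; nia.
Qed.

Lemma col_settles (G : mat2) s j :
  0 <= G 0 j * G 1 j \/ (`|G 0 j| + `|G 1 j| <= (size s)%:Z)%R ->
  0 <= (word_mx s * G) 0 j * (word_mx s * G) 1 j.
Proof.
elim/last_ind: s G => [|s b IH] G.
  by rewrite word_mx0 mul1r; move: (G 0 j) (G 1 j) => x y /= [|]; nia.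
rewrite size_rcons -cats1 word_mx_cat word_mx1 -mulrA => settled; apply: IH.
move: settled; move: j; have [p [q [r [v ->]]]] := mx2P G.
by apply: ord2_ind; case: b; rewrite mx2M !mx2E /=; nia.
Qed.

Lemma word_mx_nseq0 n : word_mx (nseq n false) = mx2 1 n%:Z 0 1.
Proof.
elim: n => [|n IH] /=; first by rewrite word_mx0 mx2_1.
by rewrite word_mx_cons IH mx2M; congr mx2; lia.
Qed.

Lemma string_weight_nseq0 n : string_weight (nseq n false) = 0%N.
Proof. by rewrite /string_weight count_nseq. Qed.

(** The products with a zero lower left entry are the powers of the letter 0,
    since a word is determined by its matrix. *)
Lemma word_mx_corner s : string_weight s != 0%N -> 0 < (word_mx s) 1 0.
Proof.
move=> wt; have s_n0 : s != [::] by case: s wt.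
have := ordered_word s_n0; have := unimodular_word s.
have [p [q [r [v eq_s]]]] := mx2P (word_mx s).
move: wt; rewrite /unimodular eq_s det_mx2 ordered_mx2 mx2E => wt uni ord.
have [//|r_le0] := ltP 0 r; case/negP: wt.
have {r_le0} r0 : r = 0 by lia.
rewrite {}r0 in eq_s uni ord.
have pv1 : p * v = 1.
  have : 0 <= p * v by rewrite mulr_ge0; lia.
  by move: uni; rewrite mulr0 subr0; lia.
have [p1 v1] : p = 1 /\ v = 1.
  by have /eqP := congr1 absz pv1; rewrite abszM muln_eq1; lia.
suff -> : s = nseq `|q|%N false by rewrite string_weight_nseq0.
apply: word_mx_inj; rewrite word_mx_nseq0 eq_s p1 v1.
by congr mx2; lia.
Qed.

(** * Words with conjugate matrices *)

(** One more factor [Q] orders the two entries of each row of [G] in absolute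
    value, and the condition on the second column rules out that the two rows
    have opposite signs. *)
Lemma settled_mul_ordered (G Q : mat2) : ordered Q -> unimodular (G * Q) ->
  (forall i, 0 <= G i 0 * G i 1) -> 0 <= (G * Q) 0 1 * (G * Q) 1 1 ->
  ordered (G * Q) \/ ordered (- (G * Q)).
Proof.
have [p [q [r [v ->]]]] := mx2P G; have [p' [q' [r' [v' ->]]]] := mx2P Q.
rewrite ordered_mx2 mx2M => ord_Q uni rows; have := rows 0; have := rows 1.
rewrite mx2N !mx2E !ordered_mx2 => row1 row0 col.
have Mrow x y : 0 <= x * y ->
    (0 <= x * p' + y * r' /\ x * p' + y * r' <= x * q' + y * v') \/
    (x * p' + y * r' <= 0 /\ x * q' + y * v' <= x * p' + y * r').
  move=> xy; have [[x0 y0]|[x0 y0]] : 0 <= x /\ 0 <= y \/ x <= 0 /\ y <= 0.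
  - by nia.
  - by left; nia.
  by right; nia.
move: uni col (Mrow p q row0) (Mrow r v row1); rewrite /unimodular det_mx2.
set a := p * p' + _; set b := p * q' + _; set c := r * p' + _.
set d := r * q' + _; move=> uni col H0 H1.
have b0 : b <> 0.
  by move=> b0; move: uni; rewrite (_ : a = 0) ?b0 ?mul0r //; lia.
have d0 : d <> 0.
  by move=> d0; move: uni; rewrite (_ : c = 0) ?d0 ?mulr0 //; lia.
have [[b_pos d_pos]|[b_neg d_neg]] : 0 < b /\ 0 < d \/ b < 0 /\ d < 0 by nia.
  by left; lia.
by right; lia.
Qed.

(** The matrix G w2^n = w1^n G intertwines the two words as G does. For large n
    its rows and its second column have no sign change, so that it is, up to
    sign, the matrix of a word [m]; then [s1 ++ m = m ++ s2] because words are
    determined by their matrices. The determinant is recorded since it tells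
    the parity of the weight of [m]. *)
Lemma conjugate_word_mx s1 s2 (G : mat2) :
  s1 != [::] -> s2 != [::] -> unimodular G ->
  word_mx s1 * G = G * word_mx s2 ->
  exists m k, s1 ++ m = m ++ s2 /\
              \det (word_mx m) = \det G * \det (word_mx s2) ^+ k.
Proof.
move=> s1_n0 s2_n0 uG s1G.
have sz1 : (0 < size s1)%N by rewrite lt0n size_eq0.
have sz2 : (0 < size s2)%N by rewrite lt0n size_eq0.
have [K rowK colK] : exists2 K : nat,
    (forall i, `|G i 0| + `|G i 1| <= K%:Z) & (`|G 0 1| + `|G 1 1| <= K%:Z).
  exists (`|(`|G 0 0| + `|G 0 1| + (`|G 1 0| + `|G 1 1|))%R|)%N; last lia.
  by apply: ord2_ind; lia.
pose M := G * word_mx s2 ^+ K.+1.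
have MG : M = word_mx s1 ^+ K.+1 * G by rewrite (intertwine_exp _ s1G).
have MQ : M = G * word_mx s2 ^+ K * word_mx s2 by rewrite -mulrA -exprSr.
have uM : unimodular M.
  by rewrite /M -word_mx_power unimodularM uG unimodular_word.
have detM : \det M = \det G * \det (word_mx s2) ^+ K.+1.
  rewrite /M detMr; congr (_ * _); elim: K.+1 => [|k IH].
    by rewrite !expr0 det1.
  by rewrite !exprS detMr IH.
have [|||ordM|ordM] := @settled_mul_ordered (G * word_mx s2 ^+ K) (word_mx s2)
  (ordered_word s2_n0); rewrite -?MQ //.
- move=> i; rewrite -word_mx_power; apply: row_settles; right.
  by apply: (le_trans (rowK i)); rewrite size_power lez_nat leq_pmulr.
- rewrite MG -word_mx_power; apply: col_settles; right.
  apply: (le_trans colK); rewrite size_power lez_nat.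
  by rewrite (leq_trans (leqnSn K)) ?leq_pmulr.
- rewrite -MQ in ordM; have [m _ eq_m] := ordered_wordP ordM uM.
  exists m, K.+1; split; last by rewrite eq_m.
  apply: word_mx_inj; rewrite !word_mx_cat eq_m {1}MG mulrA -exprS exprSr.
  by rewrite -mulrA s1G mulrA -MG.
rewrite -MQ in ordM; have [|m _ eq_m] := ordered_wordP ordM.
  by rewrite /unimodular -scaleN1r detZ expr2 mulrNN !mul1r.
exists m, K.+1; split; last by rewrite eq_m -scaleN1r detZ expr2 mulrNN !mul1r.
apply: word_mx_inj; rewrite !word_mx_cat eq_m mulrN mulNr; congr (- _).
by rewrite {1}MG mulrA -exprS exprSr -mulrA s1G mulrA -MG.
Qed.

(** * Forms as traceless matrices *)

(** For a Z-reduced form the off-diagonal entries 2A and 2(B - A - C) are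
    positive. This is, up to sign, the usual traceless matrix
    [-b -2c; 2a b] of the equivalent form f(x + y, -x); the change of variables
    is what makes the automorphs of Z-reduced forms nonnegative. *)
Definition form_mx (f : bqf) : mat2 :=
  let: (A, B, C) := f in
  mx2 (- (B - 2 * A)) (2 * A) (2 * (B - A - C)) (B - 2 * A).

Lemma form_mx_inj : injective form_mx.
Proof.
move=> [[A B] C] [[A' B'] C'] /mx2_inj[_ eqA eqC eqB].
have -> : A = A' by lia.
have -> : B = B' by lia.
by have -> : C = C' by lia.
Qed.

Lemma det_form_mx f : \det (form_mx f) = - disc f.
Proof. by case: f => [[A B] C]; rewrite det_mx2 /disc; ring. Qed.

Lemma bqf_equivP f g : bqf_equiv f g <->
  exists2 G : mat2, \det G = 1 & form_mx f * G = G * form_mx g.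
Proof.
case: f g => [[A B] C] [[A' B'] C']; split.
  move=> [a [b [c [d [abcd eq_fg]]]]].
  have := (eq_fg 1 0, eq_fg 0 1, eq_fg 1 1); rewrite /bqf_eval.
  move=> [[eqA eqC] eqB].
  have {}eqA : A' = A * a ^+ 2 + B * a * c + C * c ^+ 2.
    transitivity (A' * 1 ^+ 2 + B' * 1 * 0 + C' * 0 ^+ 2); first by ring.
    by rewrite eqA; ring.
  have {}eqC : C' = A * b ^+ 2 + B * b * d + C * d ^+ 2.
    transitivity (A' * 0 ^+ 2 + B' * 0 * 1 + C' * 1 ^+ 2); first by ring.
    by rewrite eqC; ring.
  (* [a b; c d] conjugated by the change of variables [1 1; -1 0]. *)
  exists (mx2 (d - c) (- c) (a - b + c - d) (a + c)).
    by rewrite det_mx2 -abcd; ring.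
  have {}eqB : B' = A * (a + b) ^+ 2 + B * (a + b) * (c + d) + C * (c + d) ^+ 2
    - A' - C'.
    transitivity (A' * 1 ^+ 2 + B' * 1 * 1 + C' * 1 ^+ 2 - A' - C').
      by ring.
    by rewrite eqB; ring.
  rewrite !mx2M eqB eqA eqC; congr mx2;
  by rewrite -[LHS]mul1r -{1}abcd; ring.
move=> [G]; have [p [q [r [v ->]]]] := mx2P G; rewrite det_mx2 => detG eqG.
have {eqG} : form_mx (A', B', C') =
    mx2 v (- q) (- r) p * (form_mx (A, B, C) * mx2 p q r v).
  rewrite eqG mulrA mx2M /form_mx -[LHS]mul1r mx2_1 -detG.
  by congr (mx2 _ _ _ _ * _); ring.
rewrite !mx2M => /mx2_inj[_ eqA eqC eqB].
(* The inverse conjugation. *)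
exists (q + v), (q + v - (p + r)), (- q), (p - q); split.
  by rewrite -detG; ring.
have {}eqA : A' = A * (q + v) ^+ 2 - B * (q + v) * q + C * q ^+ 2.
  by apply: (mulfI (_ : 2 != 0)) => //; rewrite eqA; ring.
have {}eqB : B' = 2 * A' - r * (2 * A * v - q * (B - 2 * A))
    + p * (v * (B - 2 * A) + 2 * q * (B - A - C)).
  by rewrite -[LHS](subrK (2 * A')) eqB; ring.
have {}eqC : C' = B' - A'
    - (p ^+ 2 * (B - A - C) + p * r * (B - 2 * A) - r ^+ 2 * A).
  apply: (mulfI (_ : 2 != 0)) => //.
  by transitivity (2 * (B' - A') - 2 * (B' - A' - C')); [|rewrite eqC]; ring.
by move=> x y; rewrite /bqf_eval eqC eqB eqA; ring.
Qed.

Lemma bqf_equiv_refl f : bqf_equiv f f.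
Proof. by apply/bqf_equivP; exists 1; rewrite ?det1 ?mulr1 ?mul1r. Qed.

Lemma bqf_equiv_sym f g : bqf_equiv f g -> bqf_equiv g f.
Proof.
move=> /bqf_equivP[G detG fG]; have [|H detH [GH HG]] := @unimodular_inv G.
  by rewrite /unimodular detG.
by apply/bqf_equivP; exists H; rewrite ?detH // (intertwine_inv GH HG fG).
Qed.

Lemma bqf_equiv_trans g f h :
  bqf_equiv f g -> bqf_equiv g h -> bqf_equiv f h.
Proof.
move=> /bqf_equivP[G detG fG] /bqf_equivP[H detH gH]; apply/bqf_equivP.
exists (G * H); first by rewrite detMr detG detH mulr1.
by rewrite mulrA fG -mulrA gH mulrA.
Qed.

Lemma disc_equiv f g : bqf_equiv f g -> disc f = disc g.
Proof.
move=> /bqf_equivP[G detG /(congr1 (fun M => \det M))].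
by rewrite !detMr detG mulr1 mul1r !det_form_mx => /oppr_inj.
Qed.

Lemma bqf_primitiveP A B C : bqf_primitive (A, B, C) <->
  forall d, (d %| A)%Z -> (d %| B)%Z -> (d %| C)%Z -> (d %| 1%R)%Z.
Proof.
rewrite /bqf_primitive; split=> [gcd1 d dA dB dC|prim].
  by rewrite -gcd1 !dvdz_gcd dA dB.
have : (gcdz (gcdz A B) C %| 1%R)%Z.
  apply: prim; last exact: dvdz_gcdr.
    exact: dvdz_trans (dvdz_gcdl _ _) (dvdz_gcdl _ _).
  exact: dvdz_trans (dvdz_gcdl _ _) (dvdz_gcdr _ _).
by rewrite dvdz1 /gcdz absz_nat => /eqP->.
Qed.

Lemma primitive_equiv f g : bqf_equiv f g -> bqf_primitive f -> bqf_primitive g.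
Proof.
move=> /bqf_equiv_sym[a [b [c [d [_]]]]].
case: f g => [[A B] C] [[A' B'] C'] eq_gf /bqf_primitiveP prim.
apply/bqf_primitiveP => e eA eB eC.
have val x y : (e %| bqf_eval (A, B, C) x y)%Z.
  by rewrite eq_gf /bqf_eval !rpredD // !dvdz_mulr.
have eA' : (e %| A)%Z.
  by have := val 1 0; rewrite /bqf_eval; congr (_ %| _)%Z; ring.
have eC' : (e %| C)%Z.
  by have := val 0 1; rewrite /bqf_eval; congr (_ %| _)%Z; ring.
apply: prim => //.
rewrite (_ : B = bqf_eval (A, B, C) 1 1 - A - C); first by rewrite !rpredB.
by rewrite /bqf_eval; ring.
Qed.

(** * Automorphs of a form *)

(** The traceless part of 2M is [u *: form_mx f], that is
    M = (t + u form_mx f) / 2 with t the trace of M; such an M multiplies the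
    form attached to [form_mx f] by [\det M]. *)
Definition automorph (M : mat2) (f : bqf) (u : int) : Prop :=
  let: (A, B, C) := f in
  [/\ M 0 1 = A * u, M 1 0 = (B - A - C) * u & M 1 1 - M 0 0 = (B - 2 * A) * u].

Lemma automorphE M f u : automorph M f u ->
  2 *: M = (M 0 0 + M 1 1) *: 1 + u *: form_mx f.
Proof.
case: f => [[A B] C]; have [p [q [r [v ->]]]] := mx2P M.
rewrite /automorph !mx2E => -[-> -> eqB]; rewrite mx2_1 /form_mx !mx2Z.
have -> : v = p + (B - 2 * A) * u by rewrite -eqB; ring.
by rewrite mx2D; congr mx2; ring.
Qed.

Lemma automorph_pell M f u : automorph M f u ->
  (M 0 0 + M 1 1) ^+ 2 - disc f * u ^+ 2 = 4 * \det M.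
Proof.
case: f => [[A B] C]; have [p [q [r [v ->]]]] := mx2P M.
rewrite /automorph !mx2E det_mx2 /disc => -[-> -> eqB].
have -> : v = p + (B - 2 * A) * u by rewrite -eqB; ring.
by ring.
Qed.

Lemma automorph_intertwine M N G f g u : automorph M f u -> automorph N g u ->
  M 0 0 + M 1 1 = N 0 0 + N 1 1 -> form_mx f * G = G * form_mx g ->
  M * G = G * N.
Proof.
move=> /automorphE eqM /automorphE eqN eq_tr fG; apply: (@scalemx_inj 2) => //.
rewrite scalerAl scalerAr eqM eqN eq_tr mulrDl mulrDr -!scalerAl -!scalerAr.
by rewrite mul1r mulr1 fG.
Qed.

Lemma automorph_comm M N f u u' :
  automorph M f u -> automorph N f u' -> M * N = N * M.
Proof.
case: f => [[A B] C]; have [p [q [r [v ->]]]] := mx2P M.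
have [p' [q' [r' [v' ->]]]] := mx2P N.
rewrite /automorph !mx2E => -[-> -> eqB] [-> -> eqB'].
have -> : v = p + (B - 2 * A) * u by rewrite -eqB; ring.
have -> : v' = p' + (B - 2 * A) * u' by rewrite -eqB'; ring.
by rewrite !mx2M; congr mx2; ring.
Qed.

(** Being scalar modulo d is visibly invariant under conjugation, and for an
    automorph of a primitive form with multiplier u it means that d divides u.
    This is how u is recovered from a conjugacy class. *)
Definition scalar_mod (d : int) (M : mat2) : Prop :=
  exists c (X : mat2), M = c *: 1 + d *: X.

Lemma scalar_mod_conj d M N G : unimodular G -> M * G = G * N ->
  scalar_mod d M -> scalar_mod d N.
Proof.
move=> uG MG [c [X eqM]]; have [H _ [GH HG]] := unimodular_inv uG.
exists c, (H * X * G); apply: (unimodular_lreg uG).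
rewrite -MG eqM mulrDl mulrDr -!scalerAl -!scalerAr mul1r mulr1.
by rewrite !mulrA GH mul1r.
Qed.

Lemma scalar_modP d M : scalar_mod d M <->
  [/\ (d %| (M 0 1)%R)%Z, (d %| (M 1 0)%R)%Z & (d %| (M 1 1 - M 0 0)%R)%Z].
Proof.
have [p [q [r [v ->]]]] := mx2P M; rewrite !mx2E; split.
  move=> [c [X]]; have [p' [q' [r' [v' ->]]]] := mx2P X.
  rewrite mx2_1 !mx2Z mx2D => /mx2_inj[-> -> -> ->].
  split; rewrite ?mulr0 ?add0r ?dvdz_mulr //.
  by rewrite (_ : _ - _ = d * (v' - p')) ?dvdz_mulr //; ring.
move=> [/dvdzP[x eq_q] /dvdzP[y eq_r] /dvdzP[z eq_v]].
exists p, (mx2 0 x y z); rewrite mx2_1 !mx2Z mx2D.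
by congr mx2; lia.
Qed.

Lemma automorph_scalar_mod M f u d : bqf_primitive f -> automorph M f u ->
  scalar_mod d M <-> (d %| u)%Z.
Proof.
case: f => [[A B] C] prim [eqA eqC eqB]; split; last first.
  by move=> du; apply/scalar_modP; rewrite eqA eqC eqB; split; apply: dvdz_mull.
move=> /scalar_modP; rewrite eqA eqC eqB => -[dA dC dB].
have dBu : (d %| B * u)%Z.
  rewrite (_ : B * u = (B - 2 * A) * u + 2 * (A * u)); last by ring.
  by apply: rpredD => //; apply: dvdz_mull.
have dCu : (d %| C * u)%Z.
  rewrite (_ : C * u = B * u - A * u - (B - A - C) * u); last by ring.
  by rewrite !rpredB.
have [x [y gcdAB]] := Bezoutz A B; have [z [w]] := Bezoutz (gcdz A B) C.
rewrite prim -gcdAB => one.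
rewrite (_ : u = z * x * (A * u) + z * y * (B * u) + w * (C * u)).
  by rewrite !rpredD // dvdz_mull.
by rewrite -[LHS]mul1r -{1}one; ring.
Qed.

(** The multipliers divide each other, since both are detected by
    scalarity modulo d; subtracting the common trace and dividing by the common
    multiplier then turns a conjugation of automorphs into a conjugation of
    the forms. *)
Lemma automorph_conj M N G f g u u' :
  unimodular G -> M * G = G * N ->
  bqf_primitive f -> 0 < u -> automorph M f u ->
  bqf_primitive g -> 0 < u' -> automorph N g u' ->
  u = u' /\ form_mx f * G = G * form_mx g.
Proof.
move=> uG MG prim_f u_gt0 fixM prim_g u'_gt0 fixN.
have [H _ [GH HG]] := unimodular_inv uG.
have uH : unimodular H.
  have : unimodular (G * H) by rewrite GH /unimodular det1.
  by rewrite unimodularM => /andP[].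
have u_u' : (u %| u')%Z.
  apply/(automorph_scalar_mod _ prim_g fixN); apply: (scalar_mod_conj uG MG).
  exact/(automorph_scalar_mod _ prim_f fixM).
have u'_u : (u' %| u)%Z.
  apply/(automorph_scalar_mod _ prim_f fixM).
  apply: (scalar_mod_conj uH (intertwine_inv GH HG MG)).
  exact/(automorph_scalar_mod _ prim_g fixN).
have eq_u : u = u'.
  have : (`|u| == `|u'|)%N by rewrite eqn_dvd -!dvdzE u_u'.
  by lia.
split=> //; move: fixN (automorphE fixM); rewrite -eq_u => /automorphE eqN eqM.
have {}eqM : u *: form_mx f = 2 *: M - (M 0 0 + M 1 1) *: 1.
  by rewrite eqM addrC addKr.
have {}eqN : u *: form_mx g = 2 *: N - (M 0 0 + M 1 1) *: 1.
  by rewrite eqN (tr_conj uG MG) addrC addKr.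
have eq_uJ : u *: (form_mx f * G) = u *: (G * form_mx g).
  rewrite scalerAl scalerAr eqM eqN mulrBl mulrBr -!scalerAl -!scalerAr MG.
  by rewrite mul1r mulr1.
by apply: (scalemx_inj _ eq_uJ); rewrite gt_eqF.
Qed.

Lemma automorph_inj M f g u u' :
  bqf_primitive f -> 0 < u -> automorph M f u ->
  bqf_primitive g -> 0 < u' -> automorph M g u' -> f = g.
Proof.
move=> prim_f u0 fixM prim_g u'0 fixM'.
have [||_] :=
  @automorph_conj M M 1 f g u u' _ _ prim_f u0 fixM prim_g u'0 fixM'.
- by rewrite /unimodular det1.
- by rewrite mulr1 mul1r.
by rewrite mulr1 mul1r => /form_mx_inj.
Qed.

(** * The form fixed by a word *)

Definition mx_content (M : mat2) : int :=
  gcdz (gcdz (M 0 1) (M 1 0)) (M 1 1 - M 0 0).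

Definition mx_form (M : mat2) : bqf :=
  let u := mx_content M in
  let A := (M 0%R 1%R %/ u)%Z in
  let A' := (M 1%R 0%R %/ u)%Z in
  let B' := ((M 1 1 - M 0 0)%R %/ u)%Z in
  (A, B' + 2 * A, B' + A - A').

Lemma sqr_diff4 (t m : int) : 0 < t -> 0 < m -> `|t ^+ 2 - m ^+ 2| <> 4.
Proof.
move=> t0 m0 tm4.
have [lt_mt|lt_tm|eq_tm] := ltgtP t m.
- have : m = t + 1 \/ t + 2 <= m by lia.
  by case => ?; nia.
- have : t = m + 1 \/ m + 2 <= t by lia.
  by case => ?; nia.
- by rewrite eq_tm subrr in tm4.
Qed.

(** The third coefficient is positive because its product with the content is
    the sum of the two differences between the columns of the matrix, which
    are not equal. The discriminant is not a square because no two positive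
    squares differ by 4 ([sqr_diff4]). *)
Lemma mx_formP s (M := word_mx s) : string_weight s != 0%N ->
  [/\ 0 < mx_content M, automorph M (mx_form M) (mx_content M),
      Zreduced (mx_form M) & bqf_primitive (mx_form M)].
Proof.
move=> wt; have s_n0 : s != [::] by case: (s) wt.
move: (ordered_word s_n0) (unimodular_word s) (word_mx_corner wt).
rewrite -/M; have [p [q [r [v eqM]]]] := mx2P M; rewrite eqM {M eqM}.
rewrite ordered_mx2 /unimodular det_mx2 mx2E => ord uni r_gt0.
have q_gt0 : 0 < q by nia.
have t_gt0 : 0 < p + v by lia.
rewrite /mx_form /mx_content !mx2E; set u := gcdz _ _.
have u_n0 : u != 0 by rewrite !gcdz_eq0 !negb_and; lia.
have u_gt0 : 0 < u by rewrite lt_def u_n0.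
have uq : (u %| q)%Z := dvdz_trans (dvdz_gcdl _ _) (dvdz_gcdl _ _).
have ur : (u %| r)%Z := dvdz_trans (dvdz_gcdl _ _) (dvdz_gcdr _ _).
have uvp : (u %| v - p)%Z := dvdz_gcdr _ _.
move: (divzK uq) (divzK ur) (divzK uvp).
set A := (q %/ u)%Z; set A' := (r %/ u)%Z; set B' := ((v - p) %/ u)%Z.
move=> eqA eqA' eqB'.
have fixM : automorph (mx2 p q r v) (A, B' + 2 * A, B' + A - A') u.
  rewrite /automorph !mx2E; split; first by rewrite eqA.
    by rewrite -eqA'; ring.
  by rewrite -eqB'; ring.
have A_gt0 : 0 < A by rewrite -(pmulr_lgt0 _ u_gt0) eqA.
have A'_gt0 : 0 < A' by rewrite -(pmulr_lgt0 _ u_gt0) eqA'.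
have C_gt0 : 0 < B' + A - A'.
  rewrite -(pmulr_lgt0 _ u_gt0) mulrBl mulrDl eqA eqA' eqB'.
  have : ~ (p = q /\ r = v).
    by move=> [eq_pq eq_rv]; rewrite eq_pq eq_rv in uni; lia.
  by lia.
split=> //.
  split; last by split=> //; lia.
  have disc_gt0 : 0 < disc (A, B' + 2 * A, B' + A - A').
    rewrite (_ : disc _ = B' ^+ 2 + 4 * (A * A')); last by rewrite /disc; ring.
    by rewrite ltr_wpDl ?sqr_ge0 // !mulr_gt0.
  split=> // -[n eq_disc].
  have := automorph_pell fixM; rewrite !mx2E det_mx2 => pell.
  apply: (@sqr_diff4 (p + v) `|n * u|) => //.
    rewrite normr_gt0 mulf_neq0 //; apply/eqP => n0.
    by move: disc_gt0; rewrite eq_disc n0.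
  rewrite real_normK ?num_real // exprMn -eq_disc pell.
  by case/orP: uni => /eqP->.
apply/bqf_primitiveP => d dA dB dC.
have dB' : (d %| B')%Z by rewrite -[B'](addrK (2 * A)) rpredB // dvdz_mull.
have dA' : (d %| A')%Z by rewrite -[A'](subKr (B' + A)) rpredB // rpredD.
have dM X x : X * u = x -> (d %| X)%Z -> (d * u %| x)%Z.
  by move=> <- dX; rewrite dvdz_mul2r.
have : (d * u %| 1 * u)%Z.
  rewrite mul1r {2}/u !dvdz_gcd -/u -andbA; apply/and3P.
  by split; [apply: dM eqA dA | apply: dM eqA' dA' | apply: dM eqB' dB'].
by rewrite dvdz_mul2r.
Qed.

(** * Continued fractions and the map sigma *)

Definition cf_mx (q : seq nat) : mat2 := \prod_(a <- q) mx2 a%:Z 1 1 0.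

Lemma cf_mx_cons a q : cf_mx (a :: q) = mx2 a%:Z 1 1 0 * cf_mx q.
Proof. by rewrite /cf_mx big_cons. Qed.

(** By T^a S T = T T^(a-1) (S T), the matrix T can be moved through the
    product of the factors [a 1; 1 0], collecting the letters of [sb q]. *)
Lemma cf_mx_word q : (0 < size q)%N -> all (leq 1) q ->
  cf_mx q = mx2 1 1 0 1 * word_mx (sb q) * mx2 0 1 1 0.
Proof.
elim: q => [//|a [|b q] IH] _ /andP[a_gt0 q_gt0].
  rewrite /cf_mx big_seq1 /= word_mx_nseq0 !mx2M.
  by congr mx2; lia.
rewrite cf_mx_cons IH //; set s := word_mx (sb (b :: q)).
rewrite [sb _]/= word_mx_cat word_mx_cons word_mx_nseq0 -/(sb (b :: q)) -/s.
rewrite !mulrA.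
by congr (_ * s * _); rewrite !mx2M; congr mx2; lia.
Qed.

Lemma cf_valueE q : all (leq 1) q ->
  exists x y : int, [/\ 0 < x, 0 <= y, cf_value q = x%:~R / y%:~R,
                        cf_mx q 0 0 = x & cf_mx q 1 0 = y].
Proof.
elim: q => [_|a q IH /= /andP[a_gt0 /IH[x [y [x_gt0 y_ge0 eq_q eq_x eq_y]]]]].
  (* The value 0 of the empty fraction is 1 / 0. *)
  exists 1, 0; split=> //.
    by rewrite /cf_mx big_nil mx2_1 mx2E.
  by rewrite /cf_mx big_nil mx2_1 mx2E.
exists (a%:Z * x + y), x; split; rewrite ?ltW //.
- have : 0 < a%:Z * x by rewrite mulr_gt0.
  by lia.
- rewrite eq_q invf_div rmorphD rmorphM /= mulrDl mulfK //.
  by rewrite intr_eq0 gt_eqF.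
- move: eq_x eq_y; rewrite cf_mx_cons.
  have [p [r [c [d ->]]]] := mx2P (cf_mx q).
  by rewrite mx2M !mx2E => -> ->; ring.
- move: eq_x eq_y; rewrite cf_mx_cons.
  have [p [r [c [d ->]]]] := mx2P (cf_mx q).
  by rewrite mx2M !mx2E => -> ->; ring.
Qed.

Lemma cf_value_word q (M := word_mx (sb q)) :
  (0 < size q)%N -> all (leq 1) q ->
  cf_value q = (M 0 1 + M 1 1)%:~R / (M 1 1)%:~R.
Proof.
move=> q_n0 q_gt0; have [x [y [_ _ -> <- <-]]] := cf_valueE q_gt0.
rewrite cf_mx_word // -/M; have [p [r [c [d ->]]]] := mx2P M.
by rewrite !mx2M !mx2E; congr (_%:~R / _%:~R); ring.
Qed.

Lemma weight_sb q : string_weight (sb q) = (size q).-1.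
Proof.
rewrite /string_weight; elim: q => [//|a [|b q] IH] /=.
  by rewrite count_nseq.
by rewrite count_cat /= count_nseq mul0n add0n -/(sb (b :: q)) IH.
Qed.

Lemma sb_surj s : exists q, [/\ (0 < size q)%N, all (leq 1) q & sb q = s].
Proof.
elim: s => [|b s [q [q_n0 q_gt0 <-]]]; first by exists [:: 1%N].
case: b; last by case: q q_n0 q_gt0 => [//|[//|a] [|b q]] _ /= q_gt0;
  [exists [:: a.+2] | exists (a.+2 :: b :: q)].
by exists (1%N :: q); split=> //; case: q q_n0 {q_gt0}.
Qed.

(** The entries of a second column are coprime and positive, so proportional
    second columns are equal. Given the determinant, the first column is then
    determined up to a multiple k of the second; since it lies between 0 and
    the second column, k is 0, or one of the two matrices is singular. *)
Lemma ordered_col_inj M N : ordered M -> unimodular M -> ordered N ->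
  \det M = \det N -> M 0 1 * N 1 1 = N 0 1 * M 1 1 -> M = N.
Proof.
have [p [q [r [v ->]]]] := mx2P M; have [p' [q' [r' [v' ->]]]] := mx2P N.
rewrite /unimodular !det_mx2 !ordered_mx2 !mx2E => ordM uni ordN eq_det cross.
have [v_gt0 v'_gt0 q_ge0 q'_ge0] : [/\ 0 < v, 0 < v', 0 <= q & 0 <= q'].
  by split; nia.
pose e := p * v - q * r.
have ee : e * e = 1 by case/orP: uni => /eqP; rewrite /e => ->.
have eq_q : q = e * q * (p' * v' - q' * r').
  by rewrite -eq_det -/e mulrAC ee mul1r.
have q'_q : (q' %| q)%Z.
  rewrite eq_q (_ : _ * _ = q' * (e * (p' * v - q * r'))) ?dvdz_mulr //.
  by transitivity (e * (p' * (q * v') - q * q' * r')); [|rewrite cross]; ring.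
have q_q' : (q %| q')%Z.
  have {1}-> : q' = q' * (e * e) by rewrite ee mulr1.
  rewrite {2}/e (_ : _ * _ = q * (e * (p * v' - r * q'))) ?dvdz_mulr //.
  by transitivity (e * (p * (q' * v) - q * q' * r)); [|rewrite -cross]; ring.
have eq_qq : q = q'.
  have : (`|q| == `|q'|)%N by rewrite eqn_dvd -!dvdzE q_q' q'_q.
  by lia.
have q_gt0 : 0 < q.
  by case: (ltgtP 0 q) q_ge0 => // q0 _; move: ordM uni; rewrite -q0; nia.
move: cross; rewrite -{}eq_qq in ordN eq_det *; clear eq_q q_q' q'_q.
move=> /(mulfI (lt0r_neq0 q_gt0)) eq_v.
rewrite {v'}eq_v in v'_gt0 ordN eq_det *.
have eq_vq : (p - p') * v = q * (r - r').
  by rewrite mulrBl mulrBr; move: eq_det; lia.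
have [k eq_k] : exists k, p - p' = k * q.
  exists (e * (p * (r - r') - r * (p - p'))).
  have -> : e * (p * (r - r') - r * (p - p')) * q =
            e * (p * (q * (r - r')) - q * r * (p - p')) by ring.
  by rewrite -eq_vq -[LHS]mul1r -ee /e; ring.
have k0 : k = 0.
  have [k_lo k_hi] : k <= 1 /\ -1 <= k by split; nia.
  have [//|[k1|k1]] : k = 0 \/ k = 1 \/ k = -1 by lia.
    rewrite k1 in eq_k; have [p_q p'0] : p = q /\ p' = 0 by lia.
    by rewrite p_q p'0 in eq_vq uni; nia.
  rewrite k1 in eq_k; have [p'_q p0] : p' = q /\ p = 0 by lia.
  by rewrite p'_q p0 in eq_vq eq_det uni; nia.
have eq_p : p = p' by rewrite k0 in eq_k; lia.
rewrite eq_p in eq_vq *; congr mx2; apply/eqP.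
rewrite -subr_eq0 -(mulrI_eq0 _ (mulfI (lt0r_neq0 q_gt0))).
by rewrite -eq_vq subrr mul0r.
Qed.

(** t and B u have the same parity because t^2 and B^2 u^2 are congruent
    modulo 4; with t = B u + 2w, the entries of the matrix are w + A u, A u,
    (B - A - C) u and w + (B - A) u. Writing q, r, c for A u, (B - A - C) u and
    C u, the determinant is (w + q)(w + c) + w r; as the trace is positive, any
    failure of -q <= w <= 0 or -c <= w makes its absolute value exceed 1. *)
Lemma pell_word f t u : Zreduced f -> pell4 (disc f) t u ->
  exists M, [/\ ordered M, unimodular M, automorph M f u & M 0 0 + M 1 1 = t].
Proof.
case: f => [[A B] C] [_ [A_gt0 B_gt0 C_gt0 ltB]] [t_gt0 u_gt0 pell].
have [w eq_w] : exists w, t = B * u + 2 * w.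
  have [w [eq_w|eq_w]] : exists w, t - B * u = 2 * w \/ t - B * u = 2 * w + 1.
    exists ((t - B * u)%R %/ 2)%Z; have := divz_eq (t - B * u) 2.
    have : (((t - B * u)%R %% 2)%Z < 2)%R by apply: ltz_pmod.
    have : (0 <= ((t - B * u)%R %% 2)%Z)%R by apply: modz_ge0.
    lia.
  - by exists w; lia.
  - have def_t : t = B * u + 2 * w + 1 by lia.
    by move: pell; rewrite def_t /disc; lia.
pose M := mx2 (w + A * u) (A * u) ((B - A - C) * u) (w + (B - A) * u).
have fixM : automorph M (A, B, C) u.
  by rewrite /M /automorph !mx2E; split=> //; ring.
have trM : M 0 0 + M 1 1 = t by rewrite /M !mx2E eq_w; ring.
have uM : unimodular M.
  have := automorph_pell fixM; rewrite trM => eq_det.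
  by move: pell; rewrite eq_det /unimodular; lia.
exists M; split=> //.
have Au : 0 < A * u by rewrite mulr_gt0.
have A'u : 0 < (B - A - C) * u by rewrite mulr_gt0 //; lia.
have Cu : 0 < C * u by rewrite mulr_gt0.
have eq_v : w + (B - A) * u = w + (B - A - C) * u + C * u by ring.
move: uM trM t_gt0; rewrite /unimodular /M det_mx2 !mx2E ordered_mx2 eq_v.
move: (A * u) ((B - A - C) * u) (C * u) Au A'u Cu.
move=> q r c q_gt0 r_gt0 c_gt0 uni tr t_gt0.
have {}uni : (w + q) * (w + c) + w * r = 1 \/ (w + q) * (w + c) + w * r = -1.
  by case/orP: uni => /eqP <-; [left|right]; ring.
have w_le0 : w <= 0 by rewrite leNgt; apply/negP => ?; nia.
have wc_ge0 : 0 <= w + c.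
  rewrite leNgt; apply/negP => ?; have [wq|wq] := leP 0 (w + q); first by nia.
  by nia.
have wq_ge0 : 0 <= w + q by rewrite leNgt; apply/negP => ?; nia.
by lia.
Qed.

(** Here z = M01 + M11 and z - A u = M11, so that the value of the continued
    fraction prescribes the direction of the second column of the matrix of
    [sb q], while the parity of the length prescribes its determinant. *)
Lemma is_betaP f (M : mat2) t u q : fundamental (disc f) = (t, u) -> 0 < u ->
  Zreduced f -> ordered M -> unimodular M -> automorph M f u ->
  M 0 0 + M 1 1 = t ->
  is_beta f q <-> [/\ (0 < size q)%N, all (leq 1) q & word_mx (sb q) = M].
Proof.
case: f => [[A B] C] fund u_gt0 [_ [A_gt0 _ _ _]] ordM uM fixM trM.
have detM := automorph_pell fixM; rewrite trM in detM.
have eq_sign : (t ^+ 2 - disc (A, B, C) * u ^+ 2 == - 4) = (\det M == - 1).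
  by rewrite detM; lia.
case: fixM => eqA _ eqB.
have q_gt0 : 0 < M 0 1 by rewrite eqA mulr_gt0.
have v_gt0 : 0 < M 1 1.
  move: ordM uM q_gt0; have [p [q' [r [v ->]]]] := mx2P M.
  by rewrite ordered_mx2 /unimodular det_mx2 !mx2E; nia.
have v_n0 : (M 1 1)%:~R != 0 :> rat by rewrite intr_eq0 gt_eqF.
have eq_z : (t + B * u)%:~R / 2 = (M 0 1 + M 1 1)%:~R :> rat.
  have -> : t + B * u = (M 0 1 + M 1 1) * 2.
    by rewrite -trM eqA mulrC; move: eqB; move: (M 0 0) (M 1 1) => x y ?; lia.
  by rewrite rmorphM /= mulfK.
rewrite /is_beta fund eq_sign eq_z -[A * u]eqA.
have -> : (M 0 1 + M 1 1)%:~R - (M 0 1)%:~R = (M 1 1)%:~R :> rat.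
  by rewrite rmorphD /= addrC addKr.
have det_sb : (0 < size q)%N ->
    \det (word_mx (sb q)) = if odd (size q) then 1 else -1.
  rewrite det_word weight_sb -signr_odd.
  by case: (size q) => [//|n] _ /=; case: odd.
split=> [[q_n0 q_pos eq_cf par]|[q_n0 q_pos eq_M]]; split=> //.
- have det_eq : \det (word_mx (sb q)) = \det M.
    rewrite det_sb //; move: par uM; rewrite /unimodular.
    by case: eqP => [-> /negbTE->|_ ->] // /orP[/eqP|/eqP].
  have eq_cross : M 0 1 * word_mx (sb q) 1 1 = word_mx (sb q) 0 1 * M 1 1.
    have v'_n0 : (word_mx (sb q) 1 1)%:~R != 0 :> rat.
      by rewrite intr_eq0 gt_eqF // word_mx11_gt0.
    move/eqP: eq_cf; rewrite cf_value_word // eqr_div //.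
    rewrite -!intrM eqr_int => /eqP.
    by move: (M 0 1) (M 1 1) (word_mx _ 0 1) (word_mx _ 1 1) => x y z w; lia.
  apply/esym/ordered_col_inj => //.
  apply: ordered_word; apply/eqP => sb0; move: eq_cross.
  by rewrite sb0 word_mx0 mx2_1 !mx2E; lia.
- by rewrite cf_value_word // eq_M.
- move: (det_sb q_n0); rewrite eq_M => ->.
  by case: odd.
Qed.

Lemma sigma_word f (M : mat2) t u : fundamental (disc f) = (t, u) -> 0 < u ->
  Zreduced f -> ordered M -> unimodular M -> automorph M f u ->
  M 0 0 + M 1 1 = t ->
  word_mx (sigma f) = M.
Proof.
move=> fund u_gt0 redf ordM uM fixM trM.
have betaP q := is_betaP q fund u_gt0 redf ordM uM fixM trM.
have [s _ eq_s] := ordered_wordP ordM uM.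
have [q [q_n0 q_pos eq_q]] := sb_surj s.
have : is_beta f (beta f).
  by apply: (xgetPex [::]); exists q; apply/betaP; rewrite eq_q.
by move/betaP => [].
Qed.

(** For A = 0 or (t, u) = (0, 0) the quotient z / (z - A u) is 0 or 1, and only
    the continued fraction reduced to the partial quotient 1, of weight 0, can
    take such a value. In particular sigma has weight 0 at the form (0, 0, 0)
    standing for the representative of a class that does not meet Z. *)
Lemma sigma_weight_neq0 A B C : string_weight (sigma (A, B, C)) != 0%N ->
  A != 0 /\ fundamental (disc (A, B, C)) != (0, 0).
Proof.
rewrite /sigma /beta; case: xgetP => [q _ beta_q wt|//].
have q_n0 : (0 < size q)%N by case: q {beta_q} wt.
have sb_n0 : sb q != [::] by apply/eqP => sb0; rewrite sb0 in wt.
have := ordered_word sb_n0; have := unimodular_word (sb q).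
have v_gt0 := word_mx11_gt0 (sb q).
move: beta_q; rewrite /is_beta; case: fundamental => t u [_ q_pos + _].
rewrite cf_value_word //; move: v_gt0.
have [p [x [r [y ->]]]] := mx2P (word_mx (sb q)).
rewrite !mx2E ordered_mx2 /unimodular det_mx2; set z := _ / 2.
move=> y_gt0 eq_cf uni ord.
have x_gt0 : 0 < x by nia.
have y_n0 : y%:~R != 0 :> rat by rewrite intr_eq0 gt_eqF.
have cf_n0 : (x + y)%:~R / y%:~R != 0 :> rat.
  by rewrite mulf_neq0 ?invr_eq0 // intr_eq0; lia.
have z_n0 : z != 0 by apply/eqP => z0; move: cf_n0; rewrite eq_cf z0 mul0r eqxx.
split; apply/eqP.
  move=> A0; move: eq_cf; rewrite A0 mul0r subr0 divff // => /eqP.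
  by rewrite -(inj_eq (mulIf y_n0)) divfK // mul1r eqr_int; lia.
by move=> [t0 u0]; move: z_n0; rewrite /z t0 u0 mulr0 addr0 mul0r eqxx.
Qed.

Lemma pell_fundamental D t u :
  pell4 D t u -> is_fundamental D (fundamental D).1 (fundamental D).2.
Proof.
move=> pell; apply: (@xgetPex _ (0, 0) [set tu | is_fundamental D tu.1 tu.2]).
have [->|/eqP D5] := eqVneq D 5.
  by exists (1, 1); split=> // t' u' [_ u'_gt0 _] /=; lia.
have pell_u : exists n : nat, `[< exists t', pell4 D t' n%:Z >].
  exists `|u|%N; apply/asboolP; exists t.
  by case: pell => t0 u0 eqtu; rewrite gez0_abs ?ltW.
case: (ex_minnP pell_u) => n /asboolP[t' pell'] min_n.
exists (t', n%:Z); split=> //= t'' u'' pell''.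
have [_ u''_gt0 _] := pell''.
have le_n : (n <= `|u''|)%N.
  by apply: min_n; apply/asboolP; exists t''; rewrite gez0_abs ?ltW.
by lia.
Qed.

Lemma sigma_pell f : Zreduced f -> string_weight (sigma f) != 0%N ->
  is_fundamental (disc f) (fundamental (disc f)).1 (fundamental (disc f)).2.
Proof.
case: f => [[A B] C] redf /sigma_weight_neq0[_].
rewrite /fundamental; case: xgetP => [tu _ //|_].
by rewrite eqxx.
Qed.

Lemma mx_form_pell s (M := word_mx s) : string_weight s != 0%N ->
  pell4 (disc (mx_form M)) (M 0 0 + M 1 1) (mx_content M).
Proof.
move=> wt; have [u_gt0 fixM _ _] := mx_formP wt.
have s_n0 : s != [::] by case: (s) wt.
have /and4P[p_ge0 _ _ _] := ordered_word s_n0.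
split=> //; first by have := word_mx11_gt0 s; rewrite -/M in p_ge0 *; lia.
rewrite (automorph_pell fixM).
by have /orP[/eqP->|/eqP->] := unimodular_word s; lia.
Qed.

(** The matrix of [s] and that of [sigma f] are automorphs of the same form,
    hence commute, so that [sigma f] is a power of [s]. Powers with exponent at
    least 2 have a larger multiplier, against the minimality of the fundamental
    solution; the only exception is the matrix [0 1; 1 1], of discriminant 5,
    where the convention for the fundamental solution selects it. *)
Lemma sigma_mx_form s : string_primitive s -> string_weight s != 0%N ->
  sigma (mx_form (word_mx s)) = s.
Proof.
move=> s_prim wt; set M := word_mx s; set f := mx_form M; set m := sigma f.
have s_n0 : s != [::] by case: (s) wt.
have [u_gt0 fixM redf _] := mx_formP wt; rewrite -/M -/f in u_gt0 fixM redf.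
have pellM := mx_form_pell wt; rewrite -/M -/f in pellM.
clearbody f.
case fund: (fundamental (disc f)) (pell_fundamental pellM) => [t u].
move=> [pell0 min_u only5]; rewrite /= in pell0 min_u only5.
have [M0 [ordM0 uM0 fixM0 trM0]] := pell_word redf pell0.
have u0_gt0 : 0 < u by case: pell0.
have eq_m := sigma_word fund u0_gt0 redf ordM0 uM0 fixM0 trM0.
rewrite -/m in eq_m.
have [|k eq_k] := @commute_power s m s_prim s_n0.
  by apply: word_mx_inj; rewrite !word_mx_cat eq_m (automorph_comm fixM fixM0).
case: k eq_k => [|[|k]] eq_k.
- move: ordM0; rewrite -eq_m eq_k word_mx0 mx2_1 ordered_mx2; lia.
- by rewrite eq_k /= cats0.
have eq_M0 : M0 = M * word_mx (flatten (nseq k.+1 s)).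
  by rewrite -eq_m eq_k [nseq _ _]/= [flatten _]/= word_mx_cat.
set s' := flatten _ in eq_M0.
have wt' : string_weight s' != 0%N.
  rewrite /s' /= /string_weight count_cat addn_eq0 negb_and.
  by rewrite -/(string_weight s) wt.
have s'_n0 : s' != [::] by case: (s') wt'.
have le_u : u <= mx_content M := min_u _ _ pellM.
suff eqM : M0 = M by apply: word_mx_inj; rewrite eq_m eqM.
move: (ordered_word s_n0) (unimodular_word s) (word_mx_corner wt) fixM.
move: (ordered_word s'_n0) (word_mx_corner wt').
move: (ordered_col1_gt0 (ordered_word s'_n0) (unimodular_word s')).
move: eq_M0 trM0 fixM0 only5 (redf) u_gt0 le_u; rewrite -/M.
have [p' [q' [r' [v' ->]]]] := mx2P (word_mx s').
move: (mx_content M) => w.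
have [p [q [r [v ->]]]] := mx2P M.
case: (f) => [[A B] C].
rewrite mx2M => -> /=; rewrite !mx2E !ordered_mx2 /unimodular !det_mx2.
set a := p * p' + _; set d := r * q' + _.
move=> tr0 [eqAu eqA'u eqBu] only5 [_ [A_gt0 _ C_gt0 ltB]] w_gt0 le_u.
move=> [q'_gt0 v'_gt0] ord' r'_gt0 ord uni r_gt0 [eqA eqA' eqB].
have q_gt0 : 0 < q by rewrite eqA mulr_gt0.
have p0 : p = 0.
  (* Minimality of u, read on the upper right entry of the power. *)
  have : p * q' + q * v' <= q by rewrite eqAu eqA ler_pM2l.
  by clear -ord q_gt0 q'_gt0 v'_gt0; nia.
have [q1 r1] : q = 1 /\ r = 1.
  by rewrite p0 mul0r sub0r in uni; clear -uni q_gt0 r_gt0; split; nia.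
have v1 : v = 1.
  have : r * p' + v * r' <= r by rewrite eqA'u eqA' ler_pM2l //; lia.
  by rewrite r1; clear -ord ord' r1 r'_gt0; nia.
have w1 : w = 1 by rewrite q1 in eqA; clear -w_gt0 A_gt0 eqA; nia.
rewrite w1 p0 q1 r1 v1 !mulr1 in eqA eqA' eqB.
have [A1 B3 C1] : [/\ A = 1, B = 3 & C = 1] by clear -eqA eqA' eqB; split; lia.
have /only5[t1 u1] : disc (A, B, C) = 5 by rewrite A1 B3 C1.
rewrite eqAu eqA'u A1 B3 C1 u1 p0 q1 r1 v1; rewrite A1 B3 u1 t1 in eqBu tr0.
by clear -eqBu tr0; clearbody a d; congr mx2; lia.
Qed.

Lemma form_of_sigma f : Zreduced f -> bqf_primitive f ->
  string_weight (sigma f) != 0%N -> mx_form (word_mx (sigma f)) = f.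
Proof.
move=> redf primf wt; have [u_gt0 fixM _ prim'] := mx_formP wt.
case fund: (fundamental (disc f)) (sigma_pell redf wt) => [t u] [pell _ _].
have [M [ordM uM fixM' trM]] := pell_word redf pell.
have u_gt0' : 0 < u by case: pell.
have eqM := sigma_word fund u_gt0' redf ordM uM fixM' trM.
by apply: (automorph_inj prim' u_gt0 fixM primf u_gt0'); rewrite eqM.
Qed.

(** Equivalent forms have the same discriminant, hence the same fundamental
    solution, and the matrices of their words are conjugate. *)
Lemma equiv_sigma_rot f g : Zreduced f -> Zreduced g -> bqf_equiv f g ->
  string_weight (sigma f) != 0%N -> exists n, sigma g = rot n (sigma f).
Proof.
move=> redf redg fg wt; have eq_disc := disc_equiv fg.
case fund: (fundamental (disc f)) (sigma_pell redf wt) => [t u] [pell _ _].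
have u_gt0 : 0 < u by case: pell.
have [M [ordM uM fixM trM]] := pell_word redf pell.
rewrite /= eq_disc in pell; have [N [ordN uN fixN trN]] := pell_word redg pell.
have eqM := sigma_word fund u_gt0 redf ordM uM fixM trM.
rewrite eq_disc in fund.
have eqN := sigma_word fund u_gt0 redg ordN uN fixN trN.
have /bqf_equivP[G detG fG] := fg.
have sf_n0 : sigma f != [::] by case: (sigma f) wt.
have sg_n0 : sigma g != [::].
  by apply/eqP => sg0; move: ordN; rewrite -eqN sg0 word_mx0 mx2_1 ordered_mx2.
have [||m [k [eq_m _]]] := @conjugate_word_mx (sigma f) (sigma g) G sf_n0 sg_n0.
- by rewrite /unimodular detG.
- by rewrite eqM eqN (automorph_intertwine fixM fixN _ fG) // trM trN.
- exact: conjugate_rot eq_m.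
Qed.

(** * Rotations of a word and classes of forms *)

Definition rot_form (s : seq bool) (n : nat) : bqf :=
  mx_form (word_mx (rot n s)).

Lemma rot_formP s n : string_primitive s -> string_weight s != 0%N ->
  [/\ Zreduced (rot_form s n), bqf_primitive (rot_form s n)
    & sigma (rot_form s n) = rot n s].
Proof.
move=> s_prim; rewrite -(string_weight_rot n) => wt.
have [_ _ red prim] := mx_formP wt; split=> //.
by apply: sigma_mx_form => //; apply: string_primitive_rot.
Qed.

(** If s = a b, then (a b) a = a (b a). *)
Lemma rot_form_intertwine s n : string_weight s != 0%N ->
  form_mx (rot_form s 0) * word_mx (take n s) =
  word_mx (take n s) * form_mx (rot_form s n).
Proof.
move=> wt; have [u_gt0 fixM _ prim] := mx_formP wt.
have wt' : string_weight (rot n s) != 0%N by rewrite string_weight_rot.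
have [u'_gt0 fixN _ prim'] := mx_formP wt'; rewrite /rot_form rot0.
have [|_ //] := automorph_conj (unimodular_word (take n s)) _
  prim u_gt0 fixM prim' u'_gt0 fixN.
by rewrite -!word_mx_cat /rot catA cat_take_drop.
Qed.

Lemma form_mx_comm M f u : automorph M f u -> form_mx f * M = M * form_mx f.
Proof.
move=> fixM; apply: (@automorph_comm _ _ f 2 u) => //.
by case: f {fixM} => [[A B] C]; rewrite /automorph !mx2E; split; ring.
Qed.

(** Passing from rotation [i] to rotation [j] through rotation 0, where a matrix
    commuting with the form can be inserted to adjust the determinant. *)
Lemma rot_form_equiv s (W : mat2) i j : string_weight s != 0%N ->
  form_mx (rot_form s 0) * W = W * form_mx (rot_form s 0) ->
  \det (word_mx (take i s)) * \det W * \det (word_mx (take j s)) = 1 ->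
  bqf_equiv (rot_form s i) (rot_form s j).
Proof.
move=> wt W_comm det1; apply/bqf_equivP.
have [H detH [GH HG]] := unimodular_inv (unimodular_word (take i s)).
exists (H * (W * word_mx (take j s))).
  by rewrite !detMr detH mulrA.
rewrite mulrA (intertwine_inv GH HG (rot_form_intertwine i wt)) -!mulrA.
by rewrite (mulrA (form_mx _)) W_comm -!mulrA rot_form_intertwine.
Qed.

(** Closing up an equivalence with the two rotations gives a matrix K that
    commutes with the form of [s], hence with the matrix of [s]. The word it
    produces commutes with [s], so it is a power of [s] and has determinant
    1; hence K has determinant 1 too. *)
Lemma even_rot_form_equiv s i j : string_primitive s ->
  string_weight s != 0%N -> ~~ odd (string_weight s) ->
  bqf_equiv (rot_form s i) (rot_form s j) ->
  \det (word_mx (take i s)) = \det (word_mx (take j s)).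
Proof.
move=> s_prim wt even_s /bqf_equivP[G detG FG].
have s_n0 : s != [::] by case: (s) wt.
have [H detH [GH HG]] := unimodular_inv (unimodular_word (take j s)).
pose K := word_mx (take i s) * (G * H).
have detK : \det K = \det (word_mx (take i s)) * \det (word_mx (take j s)).
  by rewrite !detMr detG detH mul1r.
have K_comm : form_mx (rot_form s 0) * K = K * form_mx (rot_form s 0).
  rewrite mulrA rot_form_intertwine // -!mulrA (mulrA (form_mx _)) FG -!mulrA.
  by rewrite (intertwine_inv GH HG (rot_form_intertwine j wt)).
have uK : unimodular K.
  rewrite /unimodular detK.
  case: (unimodular_det (unimodular_word (take i s))) => ->;
  by case: (unimodular_det (unimodular_word (take j s))) => ->.
have [_ fixM _ _] := mx_formP wt; rewrite /rot_form rot0 in K_comm.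
have [m [k [eq_m det_m]]] := conjugate_word_mx s_n0 s_n0 uK
  (automorph_intertwine fixM fixM (erefl _) K_comm).
have [n eq_n] := commute_power s_prim s_n0 eq_m.
have det_s : \det (word_mx s) = 1.
  by rewrite det_word -signr_odd (negbTE even_s).
have detX n' : \det (word_mx s ^+ n') = 1.
  by elim: n' => [|n' IH]; rewrite ?det1 // exprS detMr det_s IH.
move: det_m; rewrite eq_n word_mx_power detX det_s expr1n mulr1 detK.
case: (unimodular_det (unimodular_word (take i s))) => ->;
by case: (unimodular_det (unimodular_word (take j s))) => ->.
Qed.

(** The matrix of [s] commutes with its form and has determinant -1: inserting
    it corrects the sign when the prefixes have different parities. *)
Lemma odd_rot_form_equiv s i j :
  odd (string_weight s) -> bqf_equiv (rot_form s i) (rot_form s j).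
Proof.
move=> odd_s; have wt : string_weight s != 0%N by case: string_weight odd_s.
have [_ fixM _ _] := mx_formP wt; have := form_mx_comm fixM.
rewrite -[in mx_form _](rot0 s) -/(rot_form s 0) => s_comm.
have det_s : \det (word_mx s) = -1 by rewrite det_word -signr_odd odd_s.
have [eq_ij|ne_ij] :=
  eqVneq (\det (word_mx (take i s))) (\det (word_mx (take j s))).
  apply: (@rot_form_equiv s 1) => //; first by rewrite mulr1 mul1r.
  rewrite det1 eq_ij.
  by case: (unimodular_det (unimodular_word (take j s))) => ->.
apply: (rot_form_equiv wt s_comm); rewrite det_s; move: ne_ij.
case: (unimodular_det (unimodular_word (take i s))) => ->;
by case: (unimodular_det (unimodular_word (take j s))) => ->.
Qed.

Lemma even_rot_form_equivE s i j : string_primitive s ->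
  string_weight s != 0%N -> ~~ odd (string_weight s) ->
  bqf_equiv (rot_form s i) (rot_form s j) <->
  \det (word_mx (take i s)) = \det (word_mx (take j s)).
Proof.
move=> s_prim wt even_s; split; first exact: even_rot_form_equiv.
move=> eq_ij; apply: (@rot_form_equiv s 1) => //; first by rewrite mulr1 mul1r.
rewrite det1 eq_ij.
by case: (unimodular_det (unimodular_word (take j s))) => ->.
Qed.

Definition form_class (f : bqf) : set bqf := [set g | bqf_equiv f g].

Lemma form_class_eq f g : bqf_equiv f g -> form_class f = form_class g.
Proof.
move=> fg; apply/seteqP; split=> h /=; last exact: bqf_equiv_trans fg.
exact: bqf_equiv_trans (bqf_equiv_sym fg).
Qed.

Lemma sigma_rot_form s n f : Zreduced f -> bqf_primitive f ->
  string_weight s != 0%N -> sigma f = rot n s -> f = rot_form s n.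
Proof.
move=> redf primf wt sf; rewrite /rot_form -sf form_of_sigma //.
by rewrite sf string_weight_rot.
Qed.

(** A Z-reduced form equivalent to a rotation has a rotation of [s] as its
    image by sigma, and a primitive Z-reduced form is recovered from that
    image. *)
Lemma class_Zreduced s i : string_primitive s -> string_weight s != 0%N ->
  form_class (rot_form s i) `&` Zreduced =
  [set g | exists n, [/\ (n < size s)%N, g = rot_form s n
                        & bqf_equiv (rot_form s i) (rot_form s n)]].
Proof.
move=> s_prim wt; have s_n0 : s != [::] by case: (s) wt.
have [redi primi sigi] := rot_formP i s_prim wt.
apply/seteqP; split=> [g [/= ig redg]|g /= [n [lt_n -> i_n]]]; last first.
  by split=> //; have [] := rot_formP n s_prim wt.
have [|n sg] := equiv_sigma_rot redi redg ig.
  by rewrite sigi string_weight_rot.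
have primg := primitive_equiv ig primi.
have [m lt_m eq_m] : exists2 m, (m < size s)%N & sigma g = rot m s.
  have [m lt_m eq_m] := rot_lt_size (rot_add s i n) s_n0; exists m => //.
  by rewrite sg sigi rot_rot_add.
have eq_g := sigma_rot_form redg primg wt eq_m.
by exists m; split=> //; rewrite -eq_g.
Qed.

Lemma Zcaliber_rot_form s i (P : pred nat) :
  string_primitive s -> string_weight s != 0%N ->
  (forall n, bqf_equiv (rot_form s i) (rot_form s n) <-> P n) ->
  Zcaliber (form_class (rot_form s i)) = count P (iota 0 (size s)).
Proof.
move=> s_prim wt eqP; rewrite /Zcaliber class_Zreduced //.
set fs := [seq rot_form s n | n <- iota 0 (size s) & P n].
have -> : [set g | exists n, [/\ (n < size s)%N, g = rot_form s n
            & bqf_equiv (rot_form s i) (rot_form s n)]] =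
          [set` [fset g in fs]%fset].
  apply/seteqP; split=> g /=; rewrite inE.
    move=> [n [lt_n -> /eqP Pn]]; apply: map_f.
    by rewrite mem_filter Pn mem_iota.
  case/mapP=> n; rewrite mem_filter mem_iota add0n => /andP[Pn lt_n] ->.
  by exists n; split=> //; apply/eqP.
rewrite set_fsetK card_fseq undup_id ?size_map ?size_filter //.
rewrite map_inj_in_uniq ?filter_uniq ?iota_uniq //.
move=> m n; rewrite !mem_filter !mem_iota !add0n => /andP[_ lt_m] /andP[_ lt_n].
move=> /(congr1 sigma); have [_ _ ->] := rot_formP m s_prim wt.
by have [_ _ ->] := rot_formP n s_prim wt; apply: primitive_rot_inj.
Qed.

Lemma primitive_rot_class s i : string_primitive s -> string_weight s != 0%N ->
  primitive_class (form_class (rot_form s i)).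
Proof.
move=> s_prim wt; have [[indef _] prim _] := rot_formP i s_prim wt; split.
  by exists (rot_form s i).
by move=> g /primitive_equiv; apply.
Qed.

Lemma sigma_rot_class s i : string_primitive s -> string_weight s != 0%N ->
  exists n, sigma (Zrepresentative (form_class (rot_form s i))) = rot n s.
Proof.
move=> s_prim wt; have [redi _ _] := rot_formP i s_prim wt.
have : (form_class (rot_form s i) `&` Zreduced)
    (Zrepresentative (form_class (rot_form s i))).
  by apply: xgetPex; exists (rot_form s i); split=> //; apply: bqf_equiv_refl.
rewrite class_Zreduced // => -[n [_ -> _]]; exists n.
by have [_ _ ->] := rot_formP n s_prim wt.
Qed.

(** The weight being nonzero, the representative is a genuine Z-reduced form of
    the class, and it is the form of the rotation. *)
Lemma rot_class_of_sigma s n K : primitive_class K -> string_weight s != 0%N ->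
  sigma (Zrepresentative K) = rot n s -> K = form_class (rot_form s n).
Proof.
move=> [[f _ eqK] primK] wt; rewrite /Zrepresentative.
case: xgetP => [g _ [Kg redg]|_] sg; last first.
  have [|] := @sigma_weight_neq0 0 0 0; last by rewrite eqxx.
  by rewrite sg string_weight_rot.
rewrite -(sigma_rot_form redg (primK g Kg) wt sg).
by move: Kg; rewrite eqK; apply: form_class_eq.
Qed.

Lemma image_overP K s : image_over K (to_necklace s) <->
  ~~ odd (string_weight s) /\ exists n, sigma (Zrepresentative K) = rot n s.
Proof.
rewrite /image_over /sigma_bar /class_weight.
set s' := sigma _; split=> [[a]|[even_s [n sn]]].
  case: ifP => // even_s [<-]; rewrite underlyingE color_fromK.
  move/esym/to_necklaceP => [n eq_s']; split; last by exists n.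
  by rewrite -(string_weight_rot n) -eq_s' even_s.
rewrite sn string_weight_rot (negbTE even_s).
exists (to_necklace (color (rot n s))) => //.
by rewrite underlyingE color_fromK; apply/esym/to_necklaceP; exists n.
Qed.

Lemma sigma_bar_inlP K s : sigma_bar K = inl (to_necklace s) <->
  odd (string_weight s) /\ exists n, sigma (Zrepresentative K) = rot n s.
Proof.
rewrite /sigma_bar /class_weight; set s' := sigma _; split=> [|[odd_s [n sn]]].
  case: ifP => // odd_s' [] /esym/to_necklaceP[n eq_s'].
  split; last by exists n.
  by rewrite -(string_weight_rot n) -eq_s' odd_s'.
rewrite sn string_weight_rot odd_s; congr inl.
by apply/esym/to_necklaceP; exists n.
Qed.

Lemma odd_class_unique s : string_primitive s -> odd (string_weight s) ->
  exists K : set bqf,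
    unique
      (fun K' => primitive_class K' /\ sigma_bar K' = inl (to_necklace s)) K /\
    size s = Zcaliber K.
Proof.
move=> s_prim odd_s.
have wt : string_weight s != 0%N by case: string_weight odd_s.
exists (form_class (rot_form s 0)); split; last first.
  rewrite (@Zcaliber_rot_form s 0 predT) ?count_predT ?size_iota //.
  by move=> n; split=> // _; apply: odd_rot_form_equiv.
split; first split.
- exact: primitive_rot_class.
- by apply/sigma_bar_inlP; split=> //; apply: sigma_rot_class.
move=> K [primK /sigma_bar_inlP[_ [n sn]]].
rewrite (rot_class_of_sigma primK wt sn).
by apply: form_class_eq; apply: odd_rot_form_equiv.
Qed.

Lemma even_class_pair s : string_primitive s -> string_weight s != 0%N ->
  ~~ odd (string_weight s) ->
  exists K1 K2 : set bqf,
    [/\ K1 <> K2,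
        forall K, primitive_class K /\ image_over K (to_necklace s) <->
          K = K1 \/ K = K2
      & size s = (Zcaliber K1 + Zcaliber K2)%N].
Proof.
move=> s_prim wt even_s.
pose sg n := \det (word_mx (take n s)).
(* The shortest prefix of odd weight ends at the first letter 1. *)
pose j := (index true s).+1.
have sg0 : sg 0%N = 1 by rewrite /sg take0 word_mx0 det1.
have sgj : sg j = -1.
  have s_true : true \in s.
    rewrite -has_pred1 has_count; move: wt; rewrite -lt0n; congr (0 < _)%N.
    by apply: eq_count => -[].
  rewrite /sg /j (take_nth true) ?index_mem // nth_index // det_word.
  rewrite -cats1 /string_weight count_cat /=.
  suff -> : count id (take (index true s) s) = 0%N by [].
  apply/eqP; rewrite -leqn0 leqNgt -has_count.
  by apply/hasPn => -[] // /index_ltn; rewrite ltnn.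
have equivE i n := @even_rot_form_equivE s i n s_prim wt even_s.
have sgE n : sg n = 1 \/ sg n = -1 := unimodular_det (unimodular_word _).
exists (form_class (rot_form s 0)), (form_class (rot_form s j)); split.
- move=> eqK; have : form_class (rot_form s 0) (rot_form s j).
    by rewrite eqK; apply: bqf_equiv_refl.
  by move/equivE; rewrite -/(sg _) -/(sg _) sg0 sgj.
- move=> K; split=> [[primK /image_overP[_ [n sn]]]|].
    rewrite (rot_class_of_sigma primK wt sn).
    by case: (sgE n) => sgn; [left|right]; apply: form_class_eq; apply/equivE;
      rewrite -/(sg _) -/(sg _) sgn ?sg0 ?sgj.
  by case=> ->; split; try exact: primitive_rot_class;
    apply/image_overP; split=> //; apply: sigma_rot_class.
rewrite (@Zcaliber_rot_form s 0 (fun n => sg n == 1)) //; last first.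
  by move=> n; rewrite equivE -/(sg _) -/(sg _) sg0; split=> [->|/eqP->].
rewrite (@Zcaliber_rot_form s j (predC (fun n => sg n == 1))) //; last first.
  move=> n; rewrite equivE -/(sg _) -/(sg _) sgj /=.
  by case: (sgE n) => ->.
by rewrite count_predC size_iota.
Qed.

Local Close Scope classical_set_scope.
Local Close Scope ring_scope.

Theorem corollary2p8 (N : necklace bool) (l : nat)
    (N_primitive : necklace_primitive N) (N_length : necklace_length N = l) :
  (odd (necklace_weight N) ->
    exists K : set bqf,
      unique (fun K' => primitive_class K' /\ sigma_bar K' = inl N) K /\
      l = Zcaliber K) /\
  (~~ odd (necklace_weight N) -> necklace_weight N <> 0 ->
    exists K1 K2 : set bqf,
      [/\ K1 <> K2,
          forall K, primitive_class K /\ image_over K N <-> K = K1 \/ K = K2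
        & l = Zcaliber K1 + Zcaliber K2]).
Proof.
have reprN : to_necklace (repr N) = N by apply: reprK.
have s_prim := N_primitive _ reprN.
rewrite -N_length /necklace_weight /necklace_length; split=> [odd_s|even_s wt].
  by rewrite -[in inl _]reprN; apply: odd_class_unique.
move/eqP in wt; have := even_class_pair s_prim wt even_s.
by rewrite reprN.
Qed.
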